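(* Let $\theta_{n+1}=\theta_n-\alpha_n(\nabla f(\theta_n)+w_n)$, $n\ge 0$, be the stochastic gradient recursion described in the context, and let $\Lambda=\{\sup_{n\ge 0}\|\theta_n\|<\infty\}$. Suppose that: (i) $\lim_{n\to\infty}\alpha_n=0$ and $\sum_{n=0}^\infty\alpha_n=\infty$; (ii) there exists a real number $r\in(0,\infty)$ such that $w=\limsup_{n\to\infty}\max_{n\le k<a(n,1)}\left\|\sum_{i=n}^k\alpha_i\gamma_i^r w_i\right\|<\infty$ w.p.1 on $\Lambda$; (iii) for any compact set $Q\subset\mathbb{R}^{d_\theta}$ and any $a\in f(Q)$, there exist real numbers $\delta_{Q,a}\in(0,1)$, $\mu_{Q,a}\in(1,2]$, $M_{Q,a}\in[1,\infty)$ such that $|f(\theta)-a|\le M_{Q,a}\|\nabla f(\theta)\|^{\mu_{Q,a}}$ for all $\theta\in Q$ satisfying $|f(\theta)-a|\le\delta_{Q,a}$. Then, with $p=\min\{1,r\}$, $$\|\nabla f(\theta_n)\|^2=o(\gamma_n^{-p}),\qquad d(f(\theta_n),C)=o(\gamma_n^{-p})$$ w.p.1 on $\Lambda$.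
   Context: $f:\mathbb{R}^{d_\theta}\to\mathbb{R}$ is a differentiable function whose gradient $\nabla f$ is locally Lipschitz continuous. $\{\alpha_n\}_{n\ge 0}$ is a sequence of positive real numbers. On a probability space $(\Omega,\mathcal{F},P)$, $\theta_0$ is an $\mathbb{R}^{d_\theta}$-valued random variable and $\{w_n\}_{n\ge 0}$ is an $\mathbb{R}^{d_\theta}$-valued stochastic process (for each $n$, $w_n$ may be a random function of $\theta_0,\dots,\theta_n$). $\|\cdot\|$ is the Euclidean norm and $d(\cdot,\cdot)$ the induced distance. $S=\{\theta\in\mathbb{R}^{d_\theta}:\nabla f(\theta)=0\}$ and $C=\{f(\theta):\theta\in S\}$. $\gamma_0=0$ and $\gamma_n=\sum_{i=0}^{n-1}\alpha_i$ for $n\ge 1$. For $t\in(0,\infty)$, $n\ge 0$, $a(n,t)=\max\{k\ge n:\gamma_k-\gamma_n\le t\}$. ''W.p.1 on an event $A$'' means for all $\omega\in A$ outside a set of probability zero; $o$ is as $n\to\infty$ for each fixed $\omega$. *)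

(* Defs.v *)
From HB Require Import structures.
From mathcomp Require Import all_boot all_order all_algebra.
From mathcomp Require Import all_classical all_reals all_analysis.
Import Order.TTheory GRing.Theory Num.Theory.
Import numFieldNormedType.Exports.

Set Implicit Arguments.
Unset Strict Implicit.
Unset Printing Implicit Defensive.

Local Open Scope classical_set_scope.
Local Open Scope ring_scope.

(* The library norm `|x| on 'rV[R]_d is the sup norm, so the Euclidean norm is
   defined here. Both norms induce the topology used by [differentiable],
   [nbhs], [compact] and [open]. *)
Definition enorm (R : realType) (d : nat) (x : 'rV[R]_d) : R :=
  Num.sqrt (\sum_(i < d) x ord0 i ^+ 2).

Definition grad (R : realType) (d : nat) (f : 'rV[R]_d -> R) (x : 'rV[R]_d) :
    'rV[R]_d :=
  \row_(i < d) 'D_(delta_mx ord0 i) f x.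

Definition locally_lipschitz (R : realType) (d : nat)
    (g : 'rV[R]_d -> 'rV[R]_d) : Prop :=
  forall x : 'rV[R]_d, exists L : R, exists2 U : set 'rV[R]_d, nbhs x U &
    forall y z, U y -> U z -> enorm (g y - g z) <= L * enorm (y - z).

Definition stationary (R : realType) (d : nat) (f : 'rV[R]_d -> R) :
    set 'rV[R]_d :=
  [set x | grad f x = 0].

(* As [inf set0 = 0], this is the usual distance only for nonempty A. For
   A = f(S) this is harmless: if grad f(theta_n) tends to 0 along a bounded
   sequence and grad f is continuous, then S is nonempty. *)
Definition dist_set (R : realType) (x : R) (A : set R) : R :=
  inf [set `|x - y| | y in A].

Definition gamma (R : realType) (alpha : nat -> R) (n : nat) : R :=
  \sum_(0 <= i < n) alpha i.

(* The largest k >= n with gamma_k - gamma_n <= t; it exists whenever t >= 0,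
   the steps are positive and their series diverges (and it is n by convention
   when there is no largest such k). *)
Definition horizon (R : realType) (alpha : nat -> R) (n : nat) (t : R) : nat :=
  let K := [set k | (n <= k)%N /\ gamma alpha k - gamma alpha n <= t] in
  xget n [set k | K k /\ forall j, K j -> (j <= k)%N].

(* max_{n <= k < a(n,1)} || sum_{i=n}^k alpha_i gamma_i^r w_i ||; all terms are
   nonnegative, and the maximum is 0 when the index range is empty, which
   happens for only finitely many n if alpha tends to 0. *)
Definition noise_max (R : realType) (d : nat) (alpha : nat -> R) (r : R)
    (w : nat -> 'rV[R]_d) (n : nat) : R :=
  \big[Num.max/0]_(n <= k < horizon alpha n 1)
    enorm (\sum_(n <= i < k.+1) (alpha i * gamma alpha i `^ r) *: w i).

Definition random_vector (disp : measure_display) (T : measurableType disp)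
    (R : realType) (d : nat) (X : T -> 'rV[R]_d) : Prop :=
  measurable_fun setT (X : T -> g_sigma_algebraType (@open 'rV[R]_d)).

Definition bounded_paths (T : Type) (R : realType) (d : nat)
    (theta : nat -> T -> 'rV[R]_d) : set T :=
  [set omega |
    (ereal_sup (range (fun n => (enorm (theta n omega))%:E)) < +oo)%E].

(* Main.v *)
Require Import Defs.
From HB Require Import structures.
From mathcomp Require Import all_boot all_order all_algebra.
From mathcomp Require Import all_classical all_reals all_analysis.
From mathcomp Require Import ring lra zify.
Import Order.TTheory GRing.Theory Num.Theory.
Import numFieldNormedType.Exports.
Set Implicit Arguments.
Unset Strict Implicit.
Unset Printing Implicit Defensive.
Local Open Scope classical_set_scope.
Local Open Scope ring_scope.

(** The argument is pathwise. Fix a bounded path satisfying the noise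
    condition; it stays in a compact box on which [grad f] is Lipschitz with
    constant [L].

    Averaging. Summation by parts turns the noise condition into
    [|sum_(n <= i < k) alpha_i w_i| <= B gamma_n ^ -r] as long as
    [gamma_k - gamma_n <= 1]. Cut the path into blocks of [gamma]-length about
    [tau = 1 / (40 L)]. Over a block the path moves by
    [- (length) * grad f] up to a small relative error and the noise, so that
    between consecutive block ends (lemma [window_descent])
    [f' <= f - c |grad f|^2 + C gamma ^ (-2 r)],
    and inside a block everything is controlled by the left end
    (lemma [window_bounds]).

    Convergence. For [r <= 1/2] the errors are not summable over the blocks, so
    the descent alone does not make [f] converge. Let [a] be the lower limit of
    [f] along the block ends. The Lojasiewicz inequality at [a] gives
    [|grad f|^2 >= const |f - a| ^ s] with [s = 2 / mu], so
    [v = f - a] satisfies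
    [v' <= v - c |v| ^ s + C gamma ^ (-2 p)] when [v] is small, [p = min 1 r].
    Every level slightly above [a] is then a barrier that the path eventually
    cannot cross upwards, whence [v --> 0] (lemma [cvg0_of_descent]).

    Rate. Put [q = mu p], so that [q s = 2 p] and, because [mu > 1] and
    [p <= 1], [q > p] and [2 p < q + 1]. The last inequality makes
    [K gamma ^ -q] a supersolution of the recursion, which bounds [v] from above
    (lemma [descent_rate_upper]); if [v] were late below [- K gamma ^ -q] it
    would decrease from then on, contradicting [v --> 0]
    (lemma [descent_rate_lower]). Hence [|v| = O(gamma ^ -q)], and the
    descent inequality read backwards gives [|grad f|^2 = O(gamma ^ -q)].
    Since [q > p] both are [o(gamma ^ -p)].

    Finally [grad f] tends to [0] along the path, so a cluster point is critical
    and [a] is a critical value; the distance of [f] to the critical values is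
    at most [|v|]. *)

(** * The Euclidean norm *)

Definition dotp (R : realType) (d : nat) (u v : 'rV[R]_d) : R :=
  \sum_(i < d) u ord0 i * v ord0 i.

Lemma dotpC (R : realType) (d : nat) (u v : 'rV[R]_d) : dotp u v = dotp v u.
Proof. by apply: eq_bigr => i _; rewrite mulrC. Qed.

Lemma dotpDr (R : realType) (d : nat) (u v1 v2 : 'rV[R]_d) :
  dotp u (v1 + v2) = dotp u v1 + dotp u v2.
Proof. by rewrite -big_split; apply: eq_bigr => i _; rewrite mxE mulrDr. Qed.

Lemma dotpZr (R : realType) (d : nat) (u v : 'rV[R]_d) (c : R) :
  dotp u (c *: v) = c * dotp u v.
Proof. by rewrite mulr_sumr; apply: eq_bigr => i _; rewrite mxE mulrCA. Qed.

Lemma dotpBr (R : realType) (d : nat) (u v1 v2 : 'rV[R]_d) :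
  dotp u (v1 - v2) = dotp u v1 - dotp u v2.
Proof. by rewrite dotpDr -scaleN1r dotpZr mulN1r. Qed.

Lemma dotpBl (R : realType) (d : nat) (u1 u2 v : 'rV[R]_d) :
  dotp (u1 - u2) v = dotp u1 v - dotp u2 v.
Proof. by rewrite dotpC dotpBr !(dotpC v). Qed.

Lemma dotp_ge0 (R : realType) (d : nat) (u : 'rV[R]_d) : 0 <= dotp u u.
Proof. by apply: sumr_ge0 => i _; rewrite -expr2 sqr_ge0. Qed.

Lemma enorm_ge0 (R : realType) (d : nat) (u : 'rV[R]_d) : 0 <= enorm u.
Proof. exact: sqrtr_ge0. Qed.

Lemma enorm_sqr (R : realType) (d : nat) (u : 'rV[R]_d) :
  enorm u ^+ 2 = dotp u u.
Proof.
rewrite /enorm sqr_sqrtr; last by apply: sumr_ge0 => i _; rewrite sqr_ge0.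
by apply: eq_bigr => i _; rewrite expr2.
Qed.

Lemma enormZ (R : realType) (d : nat) (c : R) (u : 'rV[R]_d) :
  enorm (c *: u) = `|c| * enorm u.
Proof.
have h : enorm (c *: u) ^+ 2 = (`|c| * enorm u) ^+ 2.
  rewrite exprMn !enorm_sqr dotpZr dotpC dotpZr mulrA -expr2.
  by rewrite real_normK ?num_real.
by apply/eqP; rewrite -(@eqrXn2 _ 2) ?h ?mulr_ge0 ?enorm_ge0.
Qed.

Lemma enormN (R : realType) (d : nat) (u : 'rV[R]_d) : enorm (- u) = enorm u.
Proof. by rewrite -scaleN1r enormZ normrN1 mul1r. Qed.

Lemma enorm0 (R : realType) (d : nat) : enorm (0 : 'rV[R]_d) = 0.
Proof. by rewrite -(scale0r 0) enormZ normr0 mul0r. Qed.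

Lemma ler_coord_enorm (R : realType) (d : nat) (u : 'rV[R]_d) (i : 'I_d) :
  `|u ord0 i| <= enorm u.
Proof.
rewrite -(@ler_pXn2r _ 2) ?nnegrE ?enorm_ge0// enorm_sqr real_normK ?num_real//.
rewrite /dotp (bigD1 i)//= expr2 lerDl.
by apply: sumr_ge0 => j _; rewrite -expr2 sqr_ge0.
Qed.

Lemma enorm_eq0 (R : realType) (d : nat) (u : 'rV[R]_d) : enorm u = 0 -> u = 0.
Proof.
move=> u0; apply/rowP => i; rewrite mxE; apply/eqP.
by rewrite -normr_le0 -u0 ler_coord_enorm.
Qed.

(** Expanding [0 <= |b^2 u - (u.v) v|^2], with [b = |v|], and dividing by
    [b^2] gives the Cauchy-Schwarz inequality. *)
Lemma cauchy_schwarz (R : realType) (d : nat) (u v : 'rV[R]_d) :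
  `|dotp u v| <= enorm u * enorm v.
Proof.
rewrite -(@ler_pXn2r _ 2) ?nnegrE ?mulr_ge0 ?enorm_ge0//.
rewrite real_normK ?num_real// exprMn.
have [v0|v0] := eqVneq (enorm v) 0.
  rewrite (enorm_eq0 v0) enorm0 expr0n/= mulr0 -(scale0r 0) dotpZr mul0r.
  by rewrite expr0n.
have b0 : 0 < enorm v ^+ 2 by rewrite exprn_even_gt0//=.
have := dotp_ge0 (enorm v ^+ 2 *: u - dotp u v *: v).
rewrite dotpBl !dotpBr !dotpZr ![dotp (_ *: _) _]dotpC !dotpZr -!enorm_sqr.
rewrite (dotpC v u); set a := enorm u ^+ 2; set b := enorm v ^+ 2.
set s := dotp u v => h.
suff : 0 <= b * (a * b - s ^+ 2) by rewrite pmulr_rge0// subr_ge0.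
by apply: le_trans h _; rewrite le_eqVlt; apply/orP; left; apply/eqP; ring.
Qed.

Lemma enormD (R : realType) (d : nat) (u v : 'rV[R]_d) :
  enorm (u + v) <= enorm u + enorm v.
Proof.
rewrite -(@ler_pXn2r _ 2) ?nnegrE ?addr_ge0 ?enorm_ge0//.
have := le_trans (ler_norm _) (cauchy_schwarz u v).
rewrite sqrrD !enorm_sqr dotpDr ![dotp (_ + _) _]dotpC !dotpDr (dotpC v u).
lra.
Qed.

Lemma enormBD (R : realType) (d : nat) (u v : 'rV[R]_d) :
  enorm (u - v) <= enorm u + enorm v.
Proof. by rewrite -(enormN v) enormD. Qed.

Lemma enorm_dist_tri (R : realType) (d : nat) (x y z : 'rV[R]_d) :
  enorm (x - z) <= enorm (x - y) + enorm (y - z).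
Proof. by rewrite (le_trans _ (enormD _ _))// addrA subrK. Qed.

Lemma enorm_le_sub (R : realType) (d : nat) (u v : 'rV[R]_d) :
  enorm u <= enorm v + enorm (u - v).
Proof. by rewrite -{1}(addrNK v u) addrC enormD. Qed.

Lemma enorm_sum_nat (R : realType) (d : nat) (u : nat -> 'rV[R]_d) (n k : nat) :
  enorm (\sum_(n <= i < k) u i) <= \sum_(n <= i < k) enorm (u i).
Proof.
elim/big_ind2 : _ => //; first by rewrite enorm0.
by move=> x1 x2 y1 y2 h1 h2; rewrite (le_trans (enormD _ _))// lerD.
Qed.

Lemma norm_le_enorm (R : realType) (d : nat) (u : 'rV[R]_d) : `|u| <= enorm u.
Proof.
rewrite [leLHS]/Num.norm/= mx_normrE.
apply: bigmax_le => [|[i j] _]; first exact: enorm_ge0.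
by rewrite ord1 ler_coord_enorm.
Qed.

Lemma enorm_le_norm (R : realType) (d : nat) (u : 'rV[R]_d) :
  enorm u <= d.+1%:R * `|u|.
Proof.
rewrite -(@ler_pXn2r _ 2) ?nnegrE ?mulr_ge0 ?enorm_ge0//.
rewrite enorm_sqr exprMn.
have : dotp u u <= \sum_(i < d) `|u| ^+ 2.
  apply: ler_sum => i _; rewrite -expr2 -[leLHS]real_normK ?num_real//.
  rewrite ler_pXn2r ?nnegrE// [leRHS]/Num.norm/= mx_normrE.
  by apply: (le_bigmax (0 : R) (fun p : 'I_1 * 'I_d => `|u p.1 p.2|) (ord0, i)).
move=> /le_trans; apply; rewrite sumr_const card_ord -[leLHS]mulr_natl.
by apply: ler_wpM2r; rewrite ?sqr_ge0// -natrX ler_nat; nia.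
Qed.

(** * Gradients on compact sets *)

(** A sup-norm box containing the path is used instead of a Euclidean ball:
    it is convex, and compact as a product of segments. *)
Definition box (R : realType) (d : nat) (B : R) : set 'rV[R]_d :=
  [set v | forall i, `[- B, B]%classic (v ord0 i)].
Arguments box {R} d B.

Lemma box_compact (R : realType) (d : nat) (B : R) : compact (box d B).
Proof.
have cB (i : 'I_d) : compact `[- B, B]%classic by exact: segment_compact.
exact: (rV_compact cB).
Qed.

Lemma in_box (R : realType) (d : nat) (B : R) (u : 'rV[R]_d) :
  enorm u <= B -> box d B u.
Proof.
move=> uB i; rewrite /= in_itv/= -ler_norml.
exact: le_trans (ler_coord_enorm _ _) uB.
Qed.

Lemma box_convex (R : realType) (d : nat) (B s : R) (x y : 'rV[R]_d) :
  0 <= s <= 1 -> box d B x -> box d B y -> box d B (x + s *: (y - x)).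
Proof.
move=> /andP[s0 s1] xB yB i; move: (xB i) (yB i).
rewrite /= !in_itv/= !mxE => /andP[x1 x2] /andP[y1 y2]; nra.
Qed.

(** Each bound [|g x - g y| <= L |x - y|] holds near every point of [Q x Q] for
    [L] large: near the diagonal by local Lipschitz continuity, elsewhere since
    [g] is locally bounded and [|x - y|] is locally bounded below. Compactness
    of [Q x Q] makes [L] uniform. *)
Lemma lipschitz_on_compact (R : realType) (d : nat) (g : 'rV[R]_d -> 'rV[R]_d)
    (Q : set 'rV[R]_d) : locally_lipschitz g -> compact Q ->
  exists2 L : R, 1 <= L &
    forall x y, Q x -> Q y -> enorm (g x - g y) <= L * enorm (x - y).
Proof.
move=> lip cQ.
have /compact_near_coveringP cQQ := compact_setX cQ cQ.
have := cQQ R (pinfty_nbhs R) (fun L z =>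
  enorm (g z.1 - g z.2) <= L * enorm (z.1 - z.2)) _.
move=> /(_ _) [].
  move=> [x y] [/= Qx Qy].
  have [Lx [U Ux lipU]] := lip x; have [Ly [V Vy lipV]] := lip y.
  have [xy|xy] := eqVneq x y.
    subst y; exists (U `*` U, [set L | Lx <= L]) => /=.
      split; first by exists (U, U).
      by apply: nbhs_pinfty_ge; rewrite num_real.
    move=> [[a b] L]/= [[Ua Ub] LL].
    by rewrite (le_trans (lipU _ _ Ua Ub))// ler_wpM2r ?enorm_ge0.
  (* Two balls of radius e around x and y stay at distance at least 2 e. *)
  pose e := `|x - y| / 4.
  have e0 : 0 < e by rewrite divr_gt0// normr_gt0 subr_eq0.
  pose D : R := d.+1%:R * e.
  have D0 : 0 <= D by rewrite mulr_ge0 ?ler0n ?ltW.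
  pose K := `|Lx| * D + `|Ly| * D + enorm (g x - g y).
  have K0 : 0 <= K by rewrite !addr_ge0 ?mulr_ge0 ?enorm_ge0.
  exists ((U `&` ball x e) `*` (V `&` ball y e), [set L | K / e <= L]) => /=.
    split; last by apply: nbhs_pinfty_ge; rewrite num_real.
    exists (U `&` ball x e, V `&` ball y e) => //=.
    by split; apply: filterI => //; exact: nbhsx_ballx.
  move=> [[a b] L]/= [[[Ua xa] [Vb yb]] LL].
  move: xa yb; rewrite -ball_normE/= => xa yb.
  have gxa : enorm (g a - g x) <= `|Lx| * D.
    have Uxx : U x := nbhs_singleton Ux.
    rewrite (le_trans (lipU _ _ Ua Uxx))//.
    rewrite (le_trans (ler_wpM2r (enorm_ge0 _) (ler_norm Lx)))// ler_wpM2l//.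
    rewrite (le_trans (enorm_le_norm _))// ler_wpM2l ?ler0n// distrC.
    exact: ltW.
  have gyb : enorm (g y - g b) <= `|Ly| * D.
    have Vyy : V y := nbhs_singleton Vy.
    rewrite (le_trans (lipV _ _ Vyy Vb))//.
    rewrite (le_trans (ler_wpM2r (enorm_ge0 _) (ler_norm Ly)))// ler_wpM2l//.
    by rewrite (le_trans (enorm_le_norm _))// ler_wpM2l ?ler0n// ltW.
  have gab : enorm (g a - g b) <= K.
    have := enorm_dist_tri (g a) (g x) (g b).
    have := enorm_dist_tri (g x) (g y) (g b).
    rewrite /K; lra.
  have ab : e <= enorm (a - b).
    rewrite (le_trans _ (norm_le_enorm _))//.
    have : `|x - y| <= `|x - a| + `|a - b| + `|y - b|.
      rewrite [`|y - b|]distrC.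
      rewrite -[X in `|X|](_ : (x - a) + (a - b) + (b - y) = _).
        by rewrite (le_trans (ler_normD _ _))// lerD2r ler_normD.
      by rewrite !subrKA.
    have : `|x - y| = 4 * e by rewrite /e mulrC divfK.
    lra.
  apply: (le_trans gab); rewrite -ler_pdivrMr; last by rewrite (lt_le_trans e0).
  apply: le_trans LL; rewrite ler_wpM2l// lef_pV2// posrE//.
  exact: lt_le_trans ab.
move=> M [_ HM].
(* The threshold M is strict, hence M + 1. *)
exists (Num.max 1 (M + 1)); first by rewrite le_max lexx.
move=> x y Qx Qy.
have ltM : M < Num.max 1 (M + 1) by rewrite lt_max ltrDl ltr01 orbT.
exact: (HM _ ltM (x, y)).
Qed.

Lemma grad_dotp (R : realType) (d : nat) (f : 'rV[R]_d -> R) (x h : 'rV[R]_d) :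
  differentiable f x -> 'D_h f x = dotp (grad f x) h.
Proof.
move=> df; rewrite deriveE// {1}(row_sum_delta h) linear_sum.
apply: eq_bigr => i _; rewrite linearZ/= mxE deriveE//.
by rewrite mulrC.
Qed.

(** The mean value theorem along the segment from [x] to [y]. The constant [L]
    instead of [L / 2] saves an integration. *)
Lemma taylor_box (R : realType) (d : nat) (f : 'rV[R]_d -> R) (B L : R)
    (x y : 'rV[R]_d) :
  (forall z, differentiable f z) ->
  (forall u v, box d B u -> box d B v ->
    enorm (grad f u - grad f v) <= L * enorm (u - v)) ->
  0 <= L -> box d B x -> box d B y ->
  `|f y - f x - dotp (grad f x) (y - x)| <= L * enorm (y - x) ^+ 2.
Proof.
move=> df lip L0 xB yB; set h := y - x.
pose phi (s : R) := f (x + s *: h).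
have dphi (s : R) : is_derive s (1 : R) phi (dotp (grad f (x + s *: h)) h).
  have E : (fun t : R => t^-1 *: ((phi \o shift s) (t *: (1 : R)) - phi s)) =
      (fun t : R => t^-1 *:
        ((f \o shift (x + s *: h)) (t *: h) - f (x + s *: h))).
    apply/funext => t; rewrite /phi/=; congr (_ *: (f _ - _)).
    by rewrite [t *: 1]mulr1 scalerDl addrCA.
  have dd := @diff_derivable _ _ _ f (x + s *: h) h (df _).
  split; first by rewrite /derivable E.
  by rewrite -grad_dotp// /derive E.
have cphi : {within `[0, 1], continuous phi}.
  apply: continuous_subspaceT => s.
  apply: differentiable_continuous; apply/derivable1_diffP.
  by have [] := dphi s.
have [s] := @MVT_segment _ phi _ 0 1 ler01 (fun s _ => dphi s) cphi.
rewrite in_itv/= => s01.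
rewrite /phi scale1r scale0r addr0 subr0 mulr1 [x + h]addrC subrK => ->.
rewrite -dotpBl (le_trans (cauchy_schwarz _ _))// expr2 mulrA.
rewrite ler_wpM2r ?enorm_ge0//.
have /andP[s0 s1] := s01.
apply: (le_trans (lip _ _ (box_convex s01 xB yB) xB)).
rewrite ler_wpM2l// addrAC subrr add0r enormZ ger0_norm// ler_piMl ?enorm_ge0//.
Qed.

(** * Descent recursions for real sequences *)

Lemma powRN_le_near (R : realType) (x : nat -> R) (k eps : R) :
  x j @[j --> \oo] --> +oo -> 0 < k -> 0 < eps ->
  \forall j \near \oo, x j `^ (- k) <= eps.
Proof.
move=> xoo k0 e0; have /cvgryPge := xoo.
move=> /(_ (eps^-1 `^ k^-1)); apply: filterS => j xj.
have A0 : 0 < eps^-1 `^ k^-1 by rewrite powR_gt0// invr_gt0.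
have xj0 : 0 < x j := lt_le_trans A0 xj.
rewrite powRN -[leRHS]invrK lef_pV2 ?posrE ?invr_gt0 ?powR_gt0//.
rewrite (_ : eps^-1 = (eps^-1 `^ k^-1) `^ k).
  by apply: ge0_ler_powR; rewrite ?nnegrE ?(ltW k0) ?(ltW A0) ?(ltW xj0).
by rewrite -powRrM mulVf ?gt_eqF// powRr1// ltW// invr_gt0.
Qed.

(** The tangent line bound for the convex function [t |-> t ^ -q]. *)
Lemma powRN_drop (R : realType) (x y q : R) :
  0 < x -> x <= y <= x + 1 -> 0 <= q ->
  x `^ (- q) - q * x `^ (- q - 1) <= y `^ (- q).
Proof.
move=> x0 /andP[xy yx1] q0.
have y0 : 0 < y := lt_le_trans x0 xy.
have z0 : 0 < y / x by rewrite divr_gt0.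
have -> : y `^ (- q) = x `^ (- q) * (y / x) `^ (- q).
  by rewrite -powRM ?ltW// mulrCA divff ?gt_eqF// mulr1.
have -> : x `^ (- q - 1) = x `^ (- q) * x^-1.
  by rewrite powRD ?(gt_eqF x0) ?implybT// powR_inv1 ?ltW.
rewrite mulrCA -{1}[x `^ _]mulr1 -mulrBr ler_wpM2l ?powR_ge0//.
rewrite /powR gt_eqF// (le_trans _ (expR_ge1Dx _))// mulNr lerD2l lerN2.
rewrite ler_wpM2l//.
have := @le_ln1Dx R (y / x - 1); rewrite addrCA subrr addr0 => /(_ _) h.
rewrite (le_trans (h _)) ?ltrBrDr ?addNr//.
by rewrite lerBlDr ler_pdivrMr// mulrDl mulVf ?gt_eqF// mul1r addrC.
Qed.

(** Above the level [eps / 2] the decrease [c |v|^s] dominates the late errors,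
    and from below it a single step cannot pass [eps]; so [eps] is a barrier for
    every late passage below [eps / 2]. *)
Lemma cvg0_of_descent (R : realType) (v e : nat -> R) (c s delta : R) :
  0 < c -> 0 < s -> 0 < delta -> e j @[j --> \oo] --> (0 : R) ->
  (\forall j \near \oo, v j.+1 <= v j + e j) ->
  (\forall j \near \oo, `|v j| <= delta ->
    v j.+1 <= v j - c * `|v j| `^ s + e j) ->
  (forall eps, 0 < eps -> \forall j \near \oo, - eps <= v j) ->
  (forall eps N, 0 < eps -> exists2 j, (N <= j)%N & v j <= eps) ->
  v j @[j --> \oo] --> (0 : R).
Proof.
move=> c0 s0 d0 e_to0 step descent low freq.
apply/cvgrPdist_le => eps0 eps00.
pose eps := Num.min eps0 delta.
have eps_gt0 : 0 < eps by rewrite lt_min eps00.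
have eps2 : 0 < eps / 2 by rewrite divr_gt0.
pose eta := Num.min (eps / 2) (c * (eps / 2) `^ s).
have eta0 : 0 < eta by rewrite lt_min eps2 mulr_gt0 ?powR_gt0.
have /cvgrPdist_le /(_ _ eta0) e_small := e_to0.
have [N _ HN] : \forall j \near \oo, [/\ v j.+1 <= v j + e j,
    `|v j| <= delta -> v j.+1 <= v j - c * `|v j| `^ s + e j,
    - eps <= v j & e j <= eta].
  near=> j; split.
  - by near: j.
  - by near: j.
  - by near: j; exact: low.
  - have : `|0 - e j| <= eta by near: j.
    by rewrite sub0r normrN; apply: le_trans (ler_norm _).
have [j0 Nj0 vj0] := freq _ N eps2.
have barrier i : v (j0 + i)%N <= eps.
  elim: i => [|i IH]; first by rewrite addn0 (le_trans vj0)//; lra.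
  have [st de lo es] := HN (j0 + i)%N (leq_trans Nj0 (leq_addr _ _)).
  rewrite addnS; have [vi|vi] := leP (v (j0 + i)%N) (eps / 2).
    have : eta <= eps / 2 by rewrite ge_min lexx.
    lra.
  have vd : `|v (j0 + i)%N| <= delta.
    rewrite gtr0_norm ?(lt_trans eps2 vi)// (le_trans IH)//.
    by rewrite ge_min lexx orbT.
  have h : c * (eps / 2) `^ s <= c * `|v (j0 + i)%N| `^ s.
    rewrite ler_wpM2l ?(ltW c0)//.
    apply: ge0_ler_powR; rewrite ?nnegrE ?(ltW s0) ?(ltW eps2)//.
    by rewrite (le_trans (ltW vi))// ler_norm.
  have : eta <= c * (eps / 2) `^ s by rewrite ge_min lexx orbT.
  have := de vd; lra.
exists j0 => // j /= j0j; rewrite sub0r normrN (@le_trans _ _ eps)//.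
  rewrite ler_norml -{2}(subnKC j0j) barrier andbT.
  by have [] := HN j (leq_trans Nj0 j0j).
by rewrite ge_min lexx.
Unshelve. all: by end_near.
Qed.

(** When [v] is below [K y / 2] the decrease is not available, but the error and
    the drop [K eta y^s] of the level [K y] both fit in the remaining [K y / 2];
    otherwise the decrease is at least [c (K / 2) y^s] and pays for both. *)
Lemma supersolution_step (R : realType) (v v' y s c C K eta : R) :
  0 < c -> 0 <= C -> 1 <= s -> 0 < y <= 1 ->
  2 <= K -> 4 * C <= K -> 4 * C <= K * c ->
  0 <= eta -> eta <= 1 / 4 -> eta <= c / 4 ->
  v' <= v - c * `|v| `^ s + C * y `^ s -> v <= K * y ->
  v' <= K * (y - eta * y `^ s).
Proof.
move=> c0 C0 s1 y01 K2 K4C KCc eta0 eta1 etac v'v vK.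
have /andP[y0 y1] := y01; have y0' := ltW y0.
have ysy : y `^ s <= y := ge1r_powR y01 s1.
have ys0 : 0 <= y `^ s := powR_ge0 _ _.
have K0 : 0 <= K := le_trans (ler0n _ _) K2.
have Ky0 : 0 <= K * y by rewrite mulr_ge0.
have Kys0 : 0 <= K * y `^ s by rewrite mulr_ge0.
have Kys : K * y `^ s <= K * y by rewrite ler_wpM2l.
have [vy|vy] := leP v (K / 2 * y).
  have Cy : 4 * C * y `^ s <= K * y `^ s by rewrite ler_wpM2r.
  have ey : eta * (K * y `^ s) <= 1 / 4 * (K * y `^ s) by rewrite ler_wpM2r.
  have dec : 0 <= c * `|v| `^ s by rewrite mulr_ge0 ?powR_ge0 ?(ltW c0).
  clear -v'v vy Cy ey dec Kys Ky0; lra.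
have Cy : 4 * C * y `^ s <= K * c * y `^ s by rewrite ler_wpM2r.
have ey : eta * (K * y `^ s) <= c / 4 * (K * y `^ s) by rewrite ler_wpM2r.
have dec : c * (K / 2 * y `^ s) <= c * `|v| `^ s.
  have K21 : 1 <= K / 2 by rewrite ler_pdivlMr// mul1r.
  have K20 : 0 <= K / 2 := le_trans ler01 K21.
  rewrite ler_wpM2l ?(ltW c0)//.
  apply: (@le_trans _ _ ((K / 2 * y) `^ s)).
    by rewrite powRM// ler_wpM2r// le1r_powR.
  apply: ge0_ler_powR; rewrite ?nnegrE ?(le_trans ler01 s1) ?mulr_ge0//.
  by rewrite (le_trans (ltW vy))// ler_norm.
clear -v'v vK Cy ey dec; lra.
Qed.

(** The sequence [x ^ -q] is a supersolution of the recursion since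
    [q s < q + 1]: its decrement, of order [x ^ -(q + 1)], is small compared
    with [x ^ -(q s)]. *)
Lemma descent_rate_upper (R : realType) (x v : nat -> R) (c C s q : R) :
  0 < c -> 0 <= C -> 1 <= s -> 0 < q -> q * s < q + 1 ->
  (forall j, x j <= x j.+1 <= x j + 1) -> x j @[j --> \oo] --> +oo ->
  (\forall j \near \oo,
    v j.+1 <= v j - c * `|v j| `^ s + C * x j `^ (- (q * s))) ->
  exists2 K, 0 <= K & \forall j \near \oo, v j <= K * x j `^ (- q).
Proof.
move=> c0 C0 s1 q0 qs x_step xoo descent.
pose eta := Num.min (1 / 4) (c / 4).
have eta0 : 0 < eta by rewrite lt_min !divr_gt0.
have k0 : 0 < q + 1 - q * s by rewrite subr_gt0.
have small := powRN_le_near xoo k0 (divr_gt0 eta0 q0).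
have [N _ HN] : \forall j \near \oo, [/\ 1 <= x j,
    x j `^ (- (q + 1 - q * s)) <= eta / q &
    v j.+1 <= v j - c * `|v j| `^ s + C * x j `^ (- (q * s))].
  near=> j; split.
  - by near: j; apply: (cvgryPge x).1.
  - by near: j.
  - by near: j.
(* The first three entries serve the induction step at every rank from N on,
   where N does not depend on K; the last one starts the induction. *)
pose K := Num.max 2 (Num.max (4 * C) (Num.max (4 * C / c) (v N * x N `^ q))).
have K2 : 2 <= K by rewrite le_max lexx.
have K4C : 4 * C <= K by rewrite !le_max lexx orbT.
have KCc : 4 * C <= K * c by rewrite -ler_pdivrMr// !le_max lexx !orbT.
have KN : v N * x N `^ q <= K by rewrite !le_max lexx !orbT.
exists K; first by lra.
exists N => // j /= Nj; rewrite -(subnKC Nj).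
elim: (j - N)%N => [|i IH] {j Nj}.
  have [x1 _ _] := HN N (leqnn _).
  by rewrite addn0 powRN ler_pdivlMr// powR_gt0// (lt_le_trans ltr01).
rewrite addnS; set j := (N + i)%N in IH *.
have [x1 xs dj] := HN j (leq_addr _ _).
have x0 : 0 < x j := lt_le_trans ltr01 x1.
pose y := x j `^ (- q).
have y01 : 0 < y <= 1.
  rewrite powR_gt0//= /y powRN invf_le1 ?powR_gt0//.
  by rewrite -(powRr0 (x j)) ler_powR// ltW.
have ysE : x j `^ (- (q * s)) = y `^ s by rewrite -mulNr powRrM.
have drop : q * x j `^ (- q - 1) <= eta * y `^ s.
  rewrite -ysE (_ : - q - 1 = - (q * s) + - (q + 1 - q * s)); last by ring.
  rewrite powRD ?(gt_eqF x0) ?implybT// mulrCA mulrC ler_wpM2r ?powR_ge0//.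
  by rewrite mulrC -ler_pdivlMr.
have next : y - eta * y `^ s <= x j.+1 `^ (- q).
  apply: le_trans (powRN_drop x0 (x_step j) (ltW q0)).
  by rewrite lerD2l lerN2.
rewrite -/y in IH; rewrite ysE in dj.
have eta1 : eta <= 1 / 4 by rewrite ge_min lexx.
have etac : eta <= c / 4 by rewrite ge_min lexx orbT.
apply: (@le_trans _ _ (K * (y - eta * y `^ s))); last first.
  by rewrite ler_wpM2l// (le_trans _ K2).
exact: (supersolution_step c0 C0 s1 y01 K2 K4C KCc (ltW eta0) eta1 etac dj IH).
Unshelve. all: by end_near.
Qed.

(** Once [v] is below [- K x ^ -q], the term [c |v|^s] exceeds the error
    and [v] can only decrease further, so it cannot tend to [0]. *)
Lemma descent_rate_lower (R : realType) (x v : nat -> R) (c C s q : R) :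
  0 < c -> 0 <= C -> 1 <= s -> 0 < q ->
  (forall j, x j <= x j.+1) -> x j @[j --> \oo] --> +oo ->
  (\forall j \near \oo,
    v j.+1 <= v j - c * `|v j| `^ s + C * x j `^ (- (q * s))) ->
  v j @[j --> \oo] --> (0 : R) ->
  exists2 K, 0 <= K & \forall j \near \oo, - (K * x j `^ (- q)) <= v j.
Proof.
move=> c0 C0 s1 q0 x_step xoo descent v_to0.
have s0 : 0 < s := lt_le_trans ltr01 s1.
have [N _ HN] : \forall j \near \oo, 1 <= x j /\
    v j.+1 <= v j - c * `|v j| `^ s + C * x j `^ (- (q * s)).
  near=> j; split.
  - by near: j; apply: (cvgryPge x).1.
  - by near: j.
pose K := Num.max 1 (C / c).
have K1 : 1 <= K by rewrite le_max lexx.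
have KC : C <= K * c by rewrite -ler_pdivrMr// le_max lexx orbT.
exists K; first by lra.
exists N => // j /= Nj; rewrite leNgt; apply/negP => vj.
have K0 : 0 < K by lra.
have stay i : v (j + i)%N <= v j.
  elim: i => [|i IH]; first by rewrite addn0.
  set k := (j + i)%N in IH *.
  have [x1 dk] := HN k (leq_trans Nj (leq_addr _ _)).
  rewrite addnS -/k (le_trans _ IH)//.
  pose y := x k `^ (- q).
  have ysE : x k `^ (- (q * s)) = y `^ s by rewrite -mulNr powRrM.
  have xjk : x j <= x k.
    by apply: (homo_leq (@lexx _ R) (@le_trans _ R)) => //; exact: leq_addr.
  have [x1j _] := HN j Nj.
  have yj : y <= x j `^ (- q).
    rewrite /y !powRN lef_pV2 ?posrE ?powR_gt0 ?(lt_le_trans ltr01)//.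
    by apply: ge0_ler_powR; rewrite ?nnegrE ?(ltW q0)//; lra.
  have Kyv : K * y <= - v k.
    have : K * y <= K * x j `^ (- q) by rewrite ler_wpM2l// ltW.
    lra.
  have y0 : 0 <= y := powR_ge0 _ _.
  have : c * (K * y `^ s) <= c * `|v k| `^ s.
    rewrite ler_wpM2l ?(ltW c0)//.
    apply: (@le_trans _ _ ((K * y) `^ s)).
      rewrite powRM ?(ltW K0)//.
      by rewrite ler_wpM2r ?powR_ge0// le1r_powR.
    apply: ge0_ler_powR; rewrite ?nnegrE ?(ltW s0) ?mulr_ge0 ?(ltW K0)//.
    by rewrite (le_trans Kyv)// -normrN ler_norm.
  have : C * y `^ s <= K * c * y `^ s by rewrite ler_wpM2r ?powR_ge0.
  rewrite ysE in dk; lra.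
have vj0 : v j < 0.
  apply: lt_le_trans vj _; rewrite oppr_le0 mulr_ge0 ?powR_ge0//; lra.
have vj2 : 0 < - v j / 2 by lra.
have /cvgrPdist_le /(_ _ vj2) [M _ HM] := v_to0.
have := HM (j + M)%N (leq_addl _ _); rewrite /= sub0r.
have := ler_norm (- v (j + M)%N); have := stay M; lra.
Unshelve. all: by end_near.
Qed.

(** * The time scale and the accumulated noise *)

Lemma gammaS (R : realType) (alpha : nat -> R) (n : nat) :
  gamma alpha n.+1 = gamma alpha n + alpha n.
Proof. by rewrite /gamma big_nat_recr. Qed.

Lemma gamma_diff (R : realType) (alpha : nat -> R) (n k : nat) : (n <= k)%N ->
  gamma alpha k - gamma alpha n = \sum_(n <= i < k) alpha i.
Proof.
move=> nk; rewrite -telescope_sumr//.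
by apply: eq_bigr => i _; rewrite gammaS addrC addKr.
Qed.

Lemma gamma_le (R : realType) (alpha : nat -> R) (n k : nat) :
  (forall i, 0 < alpha i) -> (n <= k)%N -> gamma alpha n <= gamma alpha k.
Proof.
move=> a0 nk; rewrite -subr_ge0 gamma_diff// sumr_ge0// => i _.
exact: ltW.
Qed.

Lemma gamma_gt0 (R : realType) (alpha : nat -> R) (n : nat) :
  (forall i, 0 < alpha i) -> (0 < n)%N -> 0 < gamma alpha n.
Proof.
move=> a0; case: n => // n _; rewrite gammaS ltr_wpDl//.
by rewrite (le_trans _ (gamma_le a0 (leq0n n)))// /gamma big_geq.
Qed.

Lemma gamma_cvgy (R : realType) (alpha : nat -> R) :
  (forall i, 0 < alpha i) -> (\sum_(0 <= n <oo) (alpha n)%:E = +oo)%E ->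
  gamma alpha n @[n --> \oo] --> +oo.
Proof.
move=> a0 asum; apply/cvgeryP; rewrite -asum.
have -> : (fun n => (gamma alpha n)%:E) =
    (fun n => \sum_(0 <= i < n) (alpha i)%:E)%E.
  by apply/funext => n; rewrite sumEFin.
by apply: is_cvg_nneseries => n _ _; rewrite lee_fin ltW.
Qed.

Lemma horizon_ge (R : realType) (alpha : nat -> R) (n m : nat) (t : R) :
  (forall i, 0 < alpha i) -> gamma alpha n @[n --> \oo] --> +oo ->
  (n <= m)%N -> gamma alpha m - gamma alpha n <= t ->
  (m <= horizon alpha n t)%N.
Proof.
move=> a0 gy nm gm.
have [N _ HN] := (cvgryPgt (gamma alpha)).1 gy (gamma alpha n + t).
pose K k := (n <= k)%N && (gamma alpha k - gamma alpha n <= t).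
have exK : exists k, K k by exists m; rewrite /K nm.
have ubK k : K k -> (k <= N)%N.
  move=> /andP[_ Kk]; rewrite leqNgt; apply/negP => /ltnW Nk.
  by have := HN k Nk; rewrite /= ltNge addrC -lerBlDr Kk.
rewrite /horizon; set A := (X in xget _ X).
have : A (xget n A).
  apply: xgetPex; case: (ex_maxnP exK ubK) => k /andP[nk gk] kmax.
  by exists k; split => // j [nj gj]; apply: kmax; rewrite /K nj.
by move=> [_]; apply.
Qed.

(** Summation by parts: the partial sums of [c_i u_i] are a combination with
    nonnegative weights of total mass [c_n] of the partial sums of [u_i]. *)
Lemma abel_bound (R : realType) (d : nat) (c : nat -> R) (u : nat -> 'rV[R]_d)
    (B : R) (n k : nat) :
  (n <= k)%N -> 0 <= B -> (forall i, (n <= i <= k)%N -> 0 <= c i) ->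
  (forall i, (n <= i < k)%N -> c i.+1 <= c i) ->
  (forall j, (n <= j <= k)%N -> enorm (\sum_(n <= i < j) u i) <= B) ->
  enorm (\sum_(n <= i < k) c i *: u i) <= B * c n.
Proof.
move=> nk B0 c0 cdec uB; pose U j := \sum_(n <= i < j) u i.
have -> : \sum_(n <= i < k) c i *: u i =
    c k *: U k + \sum_(n <= i < k) (c i - c i.+1) *: U i.+1.
  elim: k nk {c0 cdec uB} => [|k IH] nk.
    by rewrite !big_geq// /U big_geq// scaler0 addr0.
  move: nk; rewrite leq_eqVlt => /orP[/eqP <-|nk].
    by rewrite /U !(big_geq (leqnn _)) scaler0 addr0.
  rewrite ltnS in nk.
  rewrite big_nat_recr//= IH// [in RHS]big_nat_recr//= scalerBl.
  have -> : U k.+1 = U k + u k by rewrite /U big_nat_recr.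
  rewrite !scalerDr.
  set s := \sum_(n <= i < k) _; set p := c k *: U k; set q := c k *: u k.
  set p' := c k.+1 *: U k; set q' := c k.+1 *: u k.
  rewrite [RHS]addrCA [p' + q' + _]addrC subrK.
  by rewrite addrA [s + p]addrC.
have step j : (n <= j <= k)%N -> enorm (c j *: U j) <= c j * B.
  by move=> jk; rewrite enormZ ger0_norm ?c0// ler_wpM2l ?c0// uB.
have sumB : enorm (\sum_(n <= i < k) (c i - c i.+1) *: U i.+1) <=
    (c n - c k) * B.
  rewrite (le_trans (enorm_sum_nat _ _ _))//.
  have -> : c n - c k = \sum_(n <= i < k) (c i - c i.+1).
    have := telescope_sumr c nk => h; rewrite -opprB -h -sumrN.
    by apply: eq_bigr => i _; rewrite opprB.
  rewrite mulr_suml; apply: ler_sum_nat => i ik.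
  have ci : 0 <= c i - c i.+1 by rewrite subr_ge0 cdec.
  rewrite enormZ ger0_norm// ler_wpM2l//; apply: uB.
  by move: ik => /andP[ni ik]; rewrite ik (leq_trans ni).
rewrite (le_trans (enormD _ _))//.
rewrite (le_trans (lerD (step k _) sumB)) ?nk ?leqnn//.
by rewrite -mulrDl subrKC mulrC.
Qed.

Lemma noise_max_ge (R : realType) (d : nat) (alpha : nat -> R) (r : R)
    (w : nat -> 'rV[R]_d) (n k : nat) : (n <= k < horizon alpha n 1)%N ->
  enorm (\sum_(n <= i < k.+1) (alpha i * gamma alpha i `^ r) *: w i)
    <= noise_max alpha r w n.
Proof.
move=> /andP[nk kh].
pose F k := enorm (\sum_(n <= i < k.+1) (alpha i * gamma alpha i `^ r) *: w i).
rewrite -/(F k) /noise_max -/F.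
rewrite (le_trans _ (le_bigmax_nat (x0 := 0) xpredT F nk kh))//.
by rewrite big_ltn_cond//= le_max lexx.
Qed.

(** The weight [gamma_i ^ r] in the noise condition is removed by summation by
    parts against the decreasing sequence [gamma_i ^ -r]. *)
Lemma noise_sum_le (R : realType) (d : nat) (alpha : nat -> R) (r B : R)
    (w : nat -> 'rV[R]_d) (n k : nat) :
  (forall i, 0 < alpha i) -> gamma alpha n @[n --> \oo] --> +oo ->
  0 <= r -> 0 <= B -> noise_max alpha r w n <= B ->
  (0 < n)%N -> (n <= k)%N -> gamma alpha k - gamma alpha n <= 1 ->
  enorm (\sum_(n <= i < k) alpha i *: w i) <= B * gamma alpha n `^ (- r).
Proof.
move=> a0 gy r0 B0 nB n0 nk gk.
have g0 i : (n <= i)%N -> 0 < gamma alpha i.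
  by move=> ni; rewrite gamma_gt0// (leq_trans n0).
rewrite (_ : \sum_(n <= i < k) _ = \sum_(n <= i < k)
    gamma alpha i `^ (- r) *: ((alpha i * gamma alpha i `^ r) *: w i)).
  apply: (@abel_bound _ _ (fun i => gamma alpha i `^ (- r))) => //.
  - by move=> i _; exact: powR_ge0.
  - move=> i /andP[ni _]; rewrite !powRN lef_pV2 ?posrE ?powR_gt0 ?g0//.
      apply: ge0_ler_powR; rewrite ?nnegrE ?(ltW (g0 _ _))// ?gamma_le//.
      exact: leq_trans (leqnSn _).
    exact: leq_trans (leqnSn _).
  - case=> [|j] /andP[nj jk]; first by rewrite big_geq ?enorm0.
    move: nj; rewrite leq_eqVlt => /orP[/eqP <-|nj].
      by rewrite big_geq ?enorm0.
    rewrite (le_trans _ nB)// noise_max_ge// -ltnS nj.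
    apply: horizon_ge => //; first exact: ltnW.
    by rewrite (le_trans _ gk)// lerB// gamma_le.
apply: eq_big_nat => i /andP[ni _]; rewrite scalerA mulrCA -powRD.
  by rewrite addNr powRr0 mulr1.
by rewrite (gt_eqF (g0 _ ni)) implybT.
Qed.

Lemma limn_esup_bounded (R : realType) (u : nat -> R) :
  (limn_esup (fun n => (u n)%:E) < +oo)%E ->
  exists2 B, 0 <= B & \forall n \near \oo, u n <= B.
Proof.
move=> /ereal_inf_lt[_ [V FV <-]] supV.
have ub n : V n -> ((u n)%:E <= ereal_sup ((fun n => (u n)%:E) @` V))%E.
  by move=> Vn; apply: ereal_sup_ubound; exists n.
move: supV ub; case: ereal_sup => [s| |]// _ ub.
- exists `|s| => //; apply: filterS FV => n /ub; rewrite lee_fin => /le_trans.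
  by apply; exact: ler_norm.
- exists 0 => //; apply: filterS FV => n /ub.
  by rewrite leeNy_eq.
Qed.

(** * Limits and blocks *)

Lemma le0_of_le_mul (R : realType) (y C : R) :
  0 < C -> (forall eps, 0 < eps -> y <= C * eps) -> y <= 0.
Proof.
move=> C0 H; rewrite leNgt; apply/negP => y0.
have := H _ (divr_gt0 y0 (mulr_gt0 (@ltr0Sn R 1) C0)).
rewrite (_ : C * (y / (2 * C)) = y / 2); first by lra.
by field; rewrite gt_eqF.
Qed.

(** The lower limit, characterized by the two properties the descent argument
    uses: almost all terms are above [a - eps], infinitely many are below
    [a + eps]. *)
Lemma liminf_exists (R : realType) (u : nat -> R) (A : R) :
  (forall n, `|u n| <= A) ->
  exists a, (forall eps, 0 < eps -> \forall n \near \oo, a - eps <= u n) /\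
    (forall eps N, 0 < eps -> exists2 n, (N <= n)%N & u n <= a + eps).
Proof.
move=> uA; pose D := [set b | \forall n \near \oo, b <= u n].
have DA : D (- A) by near=> n; have := uA n; rewrite ler_norml => /andP[].
have ubD : ubound D A.
  move=> b [N _ HN]; have := HN N (leqnn N); rewrite /= => /le_trans; apply.
  exact: le_trans (ler_norm _) (uA N).
have supD : has_sup D by split; [exists (- A) | exists A].
exists (sup D); split.
- move=> eps e0; have [b Db ltb] := sup_adherent e0 supD.
  by apply: filterS Db => n; apply: le_trans; exact: ltW.
- move=> eps N e0; apply: contrapT => H.
  have : D (sup D + eps).
    exists N => // n /= Nn; rewrite leNgt; apply/negP => un.
    by apply: H; exists n => //; exact: ltW.
  by move=> /(ub_le_sup supD.2); rewrite gerDl leNgt e0.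
Unshelve. all: by end_near.
Qed.

(** A cluster point of the path is critical, since the gradient is continuous
    and vanishes along the path. *)
Lemma limit_value_critical (R : realType) (d : nat) (f : 'rV[R]_d -> R)
    (g : 'rV[R]_d -> 'rV[R]_d) (Q : set 'rV[R]_d) (L a : R)
    (theta : nat -> 'rV[R]_d) :
  compact Q -> continuous f -> 0 <= L ->
  (forall x y, Q x -> Q y -> enorm (g x - g y) <= L * enorm (x - y)) ->
  (forall n, Q (theta n)) ->
  (forall eps, 0 < eps -> \forall n \near \oo, enorm (g (theta n)) <= eps) ->
  (forall eps, 0 < eps -> \forall n \near \oo, `|f (theta n) - a| <= eps) ->
  exists x, g x = 0 /\ f x = a.
Proof.
move=> cQ cf L0 lip Qth gth fth.
have [x [Qx clx]] : exists x, (Q `&` cluster (theta n @[n --> \oo])) x.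
  by apply: cQ; exists 0%N => // n _; exact: Qth.
have close eps : 0 < eps ->
    enorm (g x) <= (1 + L * d.+1%:R) * eps /\ `|f x - a| <= 2 * eps.
  move=> e0.
  pose A := [set y | [/\ Q y, enorm (g y) <= eps & `|f y - a| <= eps]].
  pose U := [set y | `|x - y| < eps /\ `|f x - f y| <= eps].
  have FA : (theta n @[n --> \oo]) A.
    change (\forall n \near \oo, A (theta n)).
    by apply: filterS (filterI (gth _ e0) (fth _ e0)) => n [].
  have xU : nbhs x U.
    near=> y; split.
      near: y; have := nbhsx_ballx x eps e0.
      by rewrite -ball_normE.
    near: y; have /cvgrPdist_le /(_ _ e0) := cf x.
    by [].
  have [y [[Qy gy fy] [xy fxy]]] := clx _ _ FA xU.
  split.
    have := enorm_le_sub (g x) (g y).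
    have := lip _ _ Qx Qy.
    have : L * enorm (x - y) <= L * d.+1%:R * eps.
      rewrite -mulrA ler_wpM2l// (le_trans (enorm_le_norm _))// ler_wpM2l//.
      exact: ltW.
    lra.
  rewrite (_ : f x - a = (f x - f y) + (f y - a)); last by rewrite addrA subrK.
  rewrite (le_trans (ler_normD _ _))//; lra.
exists x; split.
  apply: enorm_eq0; apply/eqP; rewrite eq_le enorm_ge0 andbT.
  apply: (@le0_of_le_mul _ _ (1 + L * d.+1%:R)).
    by rewrite ltr_pwDl// mulr_ge0.
  by move=> eps /close[].
apply/eqP; rewrite -subr_eq0 -normr_le0.
by apply: (@le0_of_le_mul _ _ 2) => // eps /close[].
Unshelve. all: by end_near.
Qed.

(** Closing each block as soon as its length reaches [t] overshoots by at most
    one step, hence by at most [t]. *)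
Lemma exists_blocks (R : realType) (alpha : nat -> R) (t : R) (N : nat) :
  (forall i, 0 < alpha i) -> gamma alpha n @[n --> \oo] --> +oo ->
  0 < t -> (forall n, (N <= n)%N -> alpha n <= t) ->
  exists b : nat -> nat, [/\ b 0%N = N, forall j, (b j < b j.+1)%N &
    forall j, t <= gamma alpha (b j.+1) - gamma alpha (b j) <= 2 * t].
Proof.
move=> a0 gy t0 at_.
have next n : exists m, (N <= n)%N ->
    (n < m)%N /\ t <= gamma alpha m - gamma alpha n <= 2 * t.
  have [M _ HM] := (cvgryPge (gamma alpha)).1 gy (gamma alpha n + t).
  pose P m := gamma alpha n + t <= gamma alpha m.
  have exP : exists m, P m by exists M; apply: HM => /=.
  exists (ex_minn exP) => Nn; case: ex_minnP => -[|m] Pm mmin.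
    have := gamma_le a0 (leq0n n); rewrite /P in Pm; lra.
  have nm : (n < m.+1)%N.
    rewrite ltnNge; apply/negP => /(gamma_le a0); rewrite /P in Pm; lra.
  split => //; have : ~ P m by move=> /mmin; rewrite ltnn.
  rewrite /P in Pm * => /negP; rewrite -ltNge.
  have := at_ m (leq_trans Nn nm); move: Pm; rewrite gammaS; lra.
have [F HF] := choice next.
pose b j := iter j F N.
have bN j : (N <= b j)%N.
  elim: j => //= j IH; have [h _] := HF _ IH.
  exact: leq_trans IH (ltnW h).
by exists b; split => // j; have [] := HF _ (bN j).
Qed.

Lemma in_block (b : nat -> nat) (n : nat) : (forall j, b j < b j.+1)%N ->
  (b 0 <= n)%N -> exists j, (b j <= n < b j.+1)%N.
Proof.
move=> bS; elim: n => [|n IH] b0n.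
  by exists 0%N; rewrite b0n (leq_ltn_trans (leq0n _) (bS 0%N)).
move: b0n; rewrite leq_eqVlt => /orP[/eqP <-|].
  by exists 0%N; rewrite leqnn bS.
rewrite ltnS => /IH[j /andP[h1 h2]].
have [h|h] := ltnP n.+1 (b j.+1).
  by exists j; rewrite h (leq_trans h1).
by exists j.+1; rewrite h /= (leq_ltn_trans h2 (bS _)).
Qed.

(** * Motion over a window of bounded length *)

(** Here [df] stands for an increment of [f] with linear part [p] over a
    displacement [D], and [a], [h] for the gradient norms at its two ends. *)
Lemma window_arith (R : realType) (L a D E h df p : R) :
  1 <= L -> 0 <= a -> 0 <= D -> 0 <= E -> 0 <= h -> D <= a / 20 + 2 * E ->
  `|df - p| <= L * D ^+ 2 -> `|p| <= a * D -> h <= a + L * D ->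
  `|df| <= 10 * L * (a ^+ 2 + E ^+ 2) /\
  h ^+ 2 <= 10 * L ^+ 2 * (a ^+ 2 + E ^+ 2).
Proof.
move=> L1 a0 D0 E0 h0 D1 tay cs hL.
have L0 : 0 <= L := le_trans ler01 L1.
have e2 : 0 <= E ^+ 2 := sqr_ge0 _.
have a2 : 0 <= a ^+ 2 := sqr_ge0 _.
have dE0 : 0 <= a / 20 + 2 * E := le_trans D0 D1.
split.
  have D2 : D ^+ 2 <= a ^+ 2 / 200 + 8 * E ^+ 2.
    have : D ^+ 2 <= (a / 20 + 2 * E) ^+ 2 by rewrite ler_pXn2r ?nnegrE.
    have := sqr_ge0 (a / 20 - 2 * E); clear; lra.
  have LD : L * D ^+ 2 <= L * (a ^+ 2 / 200 + 8 * E ^+ 2) by rewrite ler_wpM2l.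
  have aDL : a * D <= L * (a ^+ 2 + a ^+ 2 / 200 + 2 * E ^+ 2).
    have aD : a * D <= a ^+ 2 + a ^+ 2 / 200 + 2 * E ^+ 2.
      have : a * D <= a * (a / 20 + 2 * E) by rewrite ler_wpM2l.
      have := sqr_ge0 (a / 2 - 2 * E); have := sqr_ge0 (a - E).
      clear -a2; lra.
    exact: le_trans aD (ler_peMl (le_trans (mulr_ge0 a0 D0) aD) L1).
  have La : 0 <= L * a ^+ 2 by rewrite mulr_ge0.
  have : `|df| <= L * D ^+ 2 + a * D.
    by rewrite -[df](subrK p) (le_trans (ler_normD _ _))// lerD.
  clear -LD aDL La; lra.
have hLa : h <= L * (a + D).
  by rewrite (le_trans hL)// mulrDr lerD2r ler_peMl.
have aD0 : 0 <= L * (a + D) by rewrite mulr_ge0// addr_ge0.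
have h2 : h ^+ 2 <= (L * (a + D)) ^+ 2 by rewrite ler_pXn2r ?nnegrE.
rewrite (le_trans h2)// exprMn.
rewrite (_ : 10 * _ * _ = L ^+ 2 * (10 * (a ^+ 2 + E ^+ 2))); last by ring.
rewrite ler_wpM2l ?sqr_ge0//.
have : (a + D) ^+ 2 <= (a + (a / 20 + 2 * E)) ^+ 2.
  rewrite ler_pXn2r ?nnegrE ?lerD2l//; first exact: addr_ge0 a0 D0.
  exact: addr_ge0 a0 dE0.
have := sqr_ge0 (a - 2 * E); clear -e2 a2; lra.
Qed.

Section Drift.
Context {R : realType} {d : nat} (f : 'rV[R]_d -> R) (alpha : nat -> R)
  (theta w : nat -> 'rV[R]_d).
Hypothesis f_diff : forall x, differentiable f x.
Hypothesis alpha_gt0 : forall n, 0 < alpha n.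
Hypothesis theta_rec : forall n,
  theta n.+1 = theta n - alpha n *: (grad f (theta n) + w n).
Context (B L : R).
Hypothesis theta_box : forall n, box d B (theta n).
Hypothesis L1 : 1 <= L.
Hypothesis grad_lip : forall x y, box d B x -> box d B y ->
  enorm (grad f x - grad f y) <= L * enorm (x - y).

Local Notation g n := (grad f (theta n)).
Local Notation G n := (enorm (grad f (theta n))).
Local Notation span n k := (gamma alpha k - gamma alpha n).

Lemma theta_window (n k : nat) : (n <= k)%N ->
  theta k - theta n + span n k *: g n =
  - (\sum_(n <= i < k) alpha i *: (g i - g n) +
     \sum_(n <= i < k) alpha i *: w i).
Proof.
elim: k => [|k IH] nk.
  move: nk; rewrite leqn0 => /eqP ->.
  by rewrite !subrr scale0r !big_geq// !addr0 oppr0.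
move: nk; rewrite leq_eqVlt => /orP[/eqP <-|].
  by rewrite !subrr scale0r !big_geq// !addr0 oppr0.
rewrite ltnS => nk; rewrite !big_nat_recr//= gammaS theta_rec.
have := IH nk; set s1 := \sum_(_ <= _ < _) _; set s2 := \sum_(_ <= _ < _) _.
move=> /rowP E; apply/rowP => i; have := E i; rewrite !mxE => Ei.
apply/eqP; rewrite -subr_eq0; apply/eqP.
move/eqP: Ei; rewrite -subr_eq0 => /eqP Ei; rewrite -[RHS]Ei; ring.
Qed.

(** Over a window the path follows the frozen gradient [g n], up to the
    variation of the gradient and the accumulated noise. *)
Lemma theta_window_le (n k : nat) (D E : R) : (n <= k)%N ->
  (forall i, (n <= i < k)%N -> enorm (g i - g n) <= D) ->
  enorm (\sum_(n <= i < k) alpha i *: w i) <= E ->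
  enorm (theta k - theta n + span n k *: g n) <= span n k * D + E.
Proof.
move=> nk gD wE; rewrite theta_window// enormN (le_trans (enormD _ _))// lerD//.
rewrite (le_trans (enorm_sum_nat _ _ _))// gamma_diff// mulr_suml.
apply: ler_sum_nat => i ik; rewrite enormZ gtr0_norm// ler_wpM2l ?gD//.
exact: ltW.
Qed.

(** A discrete Gronwall argument: on a window of length at most [1 / (40 L)] the
    displacement feeds back into itself through the gradient with a factor
    below [1 / 2], so strong induction closes with the constant [2]. *)
Lemma displacement_le (tau E : R) (n k : nat) : 0 <= tau -> tau * L <= 1 / 40 ->
  (n <= k)%N -> span n k <= tau ->
  (forall i, (n <= i <= k)%N ->
    enorm (\sum_(n <= j < i) alpha j *: w j) <= E) ->
  enorm (theta k - theta n) <= 2 * (tau * G n + E).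
Proof.
move=> tau0 tauL nk kt wE; pose D := 2 * (tau * G n + E).
have G0 : 0 <= G n := enorm_ge0 _.
have E0 : 0 <= E.
  by rewrite (le_trans (enorm_ge0 _) (wE k _))// nk leqnn.
have tG0 : 0 <= tau * G n by rewrite mulr_ge0.
have D0 : 0 <= D by rewrite /D; lra.
suff : forall i, (n <= i <= k)%N -> enorm (theta i - theta n) <= D.
  by apply; rewrite nk leqnn.
elim/ltn_ind => i IH /andP[ni ik].
have si : span n i <= tau by rewrite (le_trans _ kt)// lerB// gamma_le.
have si0 : 0 <= span n i by rewrite subr_ge0 gamma_le.
have gD j : (n <= j < i)%N -> enorm (g j - g n) <= L * D.
  move=> /andP[nj ji]; rewrite (le_trans (grad_lip _ _))// ler_wpM2l//.
    exact: le_trans L1.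
  by apply: IH => //; rewrite nj (leq_trans (ltnW ji)).
have dev := theta_window_le ni gD (wE i _).
have := dev; rewrite ni ik => /(_ isT) {}dev.
have := enormBD (theta i - theta n + span n i *: g n) (span n i *: g n).
rewrite addrK enormZ ger0_norm// => tri.
have h1 : span n i * G n <= tau * G n by rewrite ler_wpM2r.
have h2 : span n i * (L * D) <= tau * (L * D).
  by rewrite ler_wpM2r// mulr_ge0// (le_trans _ L1).
have h3 : tau * L * D <= 1 / 40 * D by rewrite ler_wpM2r.
apply: le_trans tri _; clear -dev h1 h2 h3 tG0 E0.
rewrite /D in dev h2 h3 *; lra.
Qed.

(** Transfers rates from the left end of a window to its interior. *)
Lemma window_bounds (tau E : R) (n k : nat) : 0 <= tau -> tau * L <= 1 / 40 ->
  (n <= k)%N -> span n k <= tau ->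
  (forall i, (n <= i <= k)%N ->
    enorm (\sum_(n <= j < i) alpha j *: w j) <= E) ->
  `|f (theta k) - f (theta n)| <= 10 * L * (G n ^+ 2 + E ^+ 2) /\
  G k ^+ 2 <= 10 * L ^+ 2 * (G n ^+ 2 + E ^+ 2).
Proof.
move=> tau0 tauL nk kt wE.
have disp := displacement_le tau0 tauL nk kt wE.
have E0 : 0 <= E.
  by rewrite (le_trans (enorm_ge0 _) (wE k _))// nk leqnn.
have L0 : 0 <= L := le_trans ler01 L1.
have tay := taylor_box f_diff grad_lip L0 (theta_box n) (theta_box k).
have cs := cauchy_schwarz (g n) (theta k - theta n).
have gl := grad_lip (theta_box k) (theta_box n).
have tri := enorm_le_sub (g k) (g n).
have Gk0 : 0 <= G k := enorm_ge0 _.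
move: disp tay cs gl tri Gk0 (enorm_ge0 (g n)) (enorm_ge0 (theta k - theta n)).
set D := enorm (theta k - theta n); set a := G n; set df := f _ - f _.
set p := dotp _ _ => disp tay cs gl tri Gk0 a0 D0.
have tau1 : tau <= 1 / 40.
  by apply: le_trans tauL; rewrite ler_peMr.
apply: (window_arith L1 a0 D0 E0 Gk0 _ tay cs); last first.
  by apply: le_trans tri _; rewrite lerD2l.
apply: le_trans disp _; rewrite mulrDr lerD2r.
have : tau * a <= 1 / 40 * a by rewrite ler_wpM2r.
lra.
Qed.

(** Over a window of length of order [tau] the path moves by [- span * grad f]
    up to an error of relative size [tau L] and the noise, so that [f] loses a
    fixed multiple of [tau |grad f|^2], up to the square of the noise. *)
Lemma window_descent (tau E : R) (n k : nat) : 0 < tau -> tau * L = 1 / 40 ->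
  (n <= k)%N -> tau / 2 <= span n k <= tau ->
  (forall i, (n <= i <= k)%N ->
    enorm (\sum_(n <= j < i) alpha j *: w j) <= E) ->
  f (theta k) <= f (theta n) - tau / 8 * G n ^+ 2 + (8 / tau + 8 * L) * E ^+ 2.
Proof.
move=> tau0 tauL nk /andP[tk kt] wE.
have tauL' : tau * L <= 1 / 40 by rewrite tauL.
have tau0' := ltW tau0.
have L0 : 0 <= L := le_trans ler01 L1.
have disp := displacement_le tau0' tauL' nk kt wE.
have tay := taylor_box f_diff grad_lip L0 (theta_box n) (theta_box k).
pose D := 2 * (tau * G n + E).
have E0 : 0 <= E.
  by rewrite (le_trans (enorm_ge0 _) (wE k _))// nk leqnn.
have G0 : 0 <= G n := enorm_ge0 _.
have gD i : (n <= i < k)%N -> enorm (g i - g n) <= L * D.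
  move=> /andP[ni ik]; rewrite (le_trans (grad_lip _ _))// ler_wpM2l//.
  apply: displacement_le => //.
    by rewrite (le_trans _ kt)// lerB// gamma_le// ltnW.
  by move=> j /andP[nj ji]; rewrite wE// nj (leq_trans ji)// ltnW.
have := theta_window_le nk gD (wE k _); rewrite nk leqnn => /(_ isT) dev.
have cs := le_trans (ler_norm _)
  (cauchy_schwarz (g n) (theta k - theta n + span n k *: g n)).
rewrite dotpDr dotpZr -enorm_sqr in cs.
clear gD.
have {}tay := le_trans (ler_norm _) tay.
move: disp dev cs tay (enorm_ge0 (theta k - theta n)).
set De := enorm (theta k - theta n); set V := enorm (_ + _).
rewrite -/D; set a := enorm (grad f (theta n)) in D G0 *.
set T := gamma alpha k - gamma alpha n in tk kt *.
set p := dotp _ _ => disp dev cs tay De0.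
have D0 : 0 <= D by rewrite (le_trans De0).
have LD0 : 0 <= L * D by rewrite mulr_ge0.
have TLD : T * (L * D) <= D / 40.
  have : T * (L * D) <= tau * (L * D) by rewrite ler_wpM2r.
  by rewrite [tau * _]mulrA tauL; lra.
have aV : a * V <= a * (D / 40 + E) by rewrite ler_wpM2l//; lra.
have De2 : L * De ^+ 2 <= L * D ^+ 2.
  by rewrite ler_wpM2l// ler_pXn2r ?nnegrE.
have Ta : tau / 2 * a ^+ 2 <= T * a ^+ 2 by rewrite ler_wpM2r ?sqr_ge0.
have LD2 : L * D ^+ 2 <= tau / 5 * a ^+ 2 + 8 * L * E ^+ 2.
  have : L * D ^+ 2 <= L * (8 * ((tau * a) ^+ 2 + E ^+ 2)).
    rewrite ler_wpM2l// /D; have := sqr_ge0 (tau * a - E); lra.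
  have -> : L * (8 * ((tau * a) ^+ 2 + E ^+ 2)) =
      (tau * L) * (8 * tau * a ^+ 2) + 8 * L * E ^+ 2 by ring.
  rewrite tauL; lra.
have tt : tau * tau^-1 = 1 by rewrite divff ?gt_eqF.
(* Half of the decrease tau / 4 * a^2 absorbs the cross term. *)
have young : 2 * (a * E) <= tau / 8 * a ^+ 2 + 8 / tau * E ^+ 2.
  have h : 0 <= tau^-1 * (tau * a - 8 * E) ^+ 2.
    by rewrite mulr_ge0 ?sqr_ge0// invr_ge0.
  have -> : tau / 8 * a ^+ 2 + 8 / tau * E ^+ 2 = 2 * (a * E) +
     tau^-1 * (tau * a - 8 * E) ^+ 2 / 8.
    have -> : tau^-1 * (tau * a - 8 * E) ^+ 2 = (tau * tau^-1) * (tau * a ^+ 2)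
      - (tau * tau^-1) * (16 * (a * E)) + 64 * (tau^-1 * E ^+ 2) by ring.
    by rewrite tt; lra.
  lra.
have aE0 : 0 <= a * E by rewrite mulr_ge0.
rewrite /D in aV; clear -tay cs aV De2 Ta LD2 young aE0; lra.
Qed.

End Drift.

(** * Rates along blocks and along the path *)

Lemma powRN_expr2 (R : realType) (x p : R) :
  (x `^ (- p)) ^+ 2 = x `^ (- (2 * p)).
Proof. by rewrite -powR_mulrn ?powR_ge0// -powRrM mulNr [p * _]mulrC. Qed.

Lemma powRN_mono (R : realType) (x p q : R) : 1 <= x -> p <= q ->
  x `^ (- q) <= x `^ (- p).
Proof. by move=> x1 pq; rewrite ler_powR// lerN2. Qed.

(** What the rest of the proof uses of a path: along the block ends [b j] the
    function decreases up to an error of order [gamma ^ (-2 p)], and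
    inside a block it is controlled by the data at the left end. *)
Definition descends_along_blocks (R : realType) (F G gam : nat -> R) (p c C : R)
    (b : nat -> nat) : Prop :=
  [/\ forall j, (b j < b j.+1)%N,
      forall j, 1 <= gam (b j),
      forall j, gam (b j) <= gam (b j.+1) <= gam (b j) + 1,
      forall j, F (b j.+1) <=
        F (b j) - c * G (b j) ^+ 2 + C * gam (b j) `^ (- (2 * p)) &
      forall j n, (b j <= n < b j.+1)%N ->
        [/\ gam (b j) <= gam n <= gam (b j) + 1,
            `|F n - F (b j)| <=
              C * (G (b j) ^+ 2 + gam (b j) `^ (- (2 * p))) &
            G n ^+ 2 <= C * (G (b j) ^+ 2 + gam (b j) `^ (- (2 * p)))]].

(** Blocks of length about [tau = 1 / (40 L)], started late enough that the
    noise bound, [gamma >= 1] and [alpha <= tau / 2] hold. The accumulated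
    noise is [O(gamma ^ -r)], which is [O(gamma ^ -p)]. *)
Lemma exists_descending_blocks (R : realType) (d : nat) (f : 'rV[R]_d -> R)
    (alpha : nat -> R) (theta w : nat -> 'rV[R]_d) (r p B Bn L : R) :
  (forall x, differentiable f x) -> (forall n, 0 < alpha n) ->
  (forall n, theta n.+1 = theta n - alpha n *: (grad f (theta n) + w n)) ->
  (forall n, box d B (theta n)) -> 1 <= L ->
  (forall x y, box d B x -> box d B y ->
    enorm (grad f x - grad f y) <= L * enorm (x - y)) ->
  alpha n @[n --> \oo] --> (0 : R) -> gamma alpha n @[n --> \oo] --> +oo ->
  0 < r -> p <= r -> 0 <= Bn ->
  (\forall n \near \oo, noise_max alpha r w n <= Bn) ->
  exists c C b, [/\ 0 < c, 0 <= C &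
    descends_along_blocks (f \o theta) (fun n => enorm (grad f (theta n)))
      (gamma alpha) p c C b].
Proof.
move=> df a0 rec thb L1 lip al0 gy r0 pr Bn0 noise.
have L0 : 0 < L := lt_le_trans ltr01 L1.
pose tau := (40 * L)^-1.
have tau0 : 0 < tau by rewrite invr_gt0 mulr_gt0.
have tauL : tau * L = 1 / 40.
  by rewrite /tau invfM -mulrA mulVf ?gt_eqF// mulr1 mul1r.
have tau1 : tau <= 1.
  by rewrite -[leRHS]invr1 lef_pV2 ?posrE ?mulr_gt0//; lra.
have tau2 : 0 < tau / 2 by rewrite divr_gt0.
have [N _ HN] : \forall n \near \oo, [/\ (0 < n)%N, 1 <= gamma alpha n,
    alpha n <= tau / 2 & noise_max alpha r w n <= Bn].
  near=> n; split.
  - by near: n; exists 1%N.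
  - by near: n; apply: (cvgryPge _).1.
  - have : `|0 - alpha n| <= tau / 2.
      by near: n; have /cvgrPdist_le := al0; apply.
    by rewrite sub0r normrN; apply: le_trans; exact: ler_norm.
  - by near: n.
have [|b [b0 bS bt]] := exists_blocks (N := N) a0 gy tau2.
  by move=> n Nn; have [] := HN n Nn.
have bN j : (N <= b j)%N.
  elim: j => [|j IH]; first by rewrite b0.
  by rewrite (leq_trans IH)// ltnW.
pose E n := Bn * gamma alpha n `^ (- r).
have E2 n : (N <= n)%N ->
    E n ^+ 2 <= Bn ^+ 2 * gamma alpha n `^ (- (2 * p)).
  move=> Nn; have [_ g1 _ _] := HN n Nn.
  rewrite exprMn ler_wpM2l ?sqr_ge0// -powRN_expr2.
  by rewrite ler_pXn2r ?nnegrE ?powR_ge0// powRN_mono.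
have wE n k : (N <= n)%N -> (n <= k)%N ->
    gamma alpha k - gamma alpha n <= tau -> forall i, (n <= i <= k)%N ->
    enorm (\sum_(n <= j < i) alpha j *: w j) <= E n.
  move=> Nn nk gt i /andP[ni ik]; have [n0 _ _ nB] := HN n Nn.
  apply: noise_sum_le => //; first exact: ltW.
  rewrite (le_trans _ tau1)// (le_trans _ gt)// lerB//; exact: gamma_le.
have bt' j : tau / 2 <= gamma alpha (b j.+1) - gamma alpha (b j) <= tau.
  by have := bt j; rewrite mulrCA divff// mulr1.
pose c := tau / 8.
(* C1 and C2 are the constants of the descent and of the window bounds; C
   absorbs in addition the constant Bn of the noise. *)
pose C1 := 8 / tau + 8 * L.
have C10 : 0 <= C1.
  by apply: addr_ge0; [apply: divr_ge0|apply: mulr_ge0];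
    rewrite ?(ltW tau0) ?(ltW L0).
pose C2 := 10 * L ^+ 2.
have C20 : 0 <= C2 by rewrite mulr_ge0 ?ler0n ?sqr_ge0.
have LC2 : 10 * L <= C2 by rewrite /C2 expr2 ler_wpM2l// ler_peMl// ltW.
pose C := (C1 + C2) * (1 + Bn ^+ 2).
have B20 : 0 <= Bn ^+ 2 := sqr_ge0 _.
have CC2 : C2 <= C.
  apply: (@le_trans _ _ (C1 + C2)); first by rewrite lerDr.
  by rewrite /C ler_peMr ?lerDl// addr_ge0.
have C2B : C2 * Bn ^+ 2 <= C.
  by apply: ler_pM; rewrite ?lerDr.
have C1B : C1 * Bn ^+ 2 <= C.
  by apply: ler_pM; rewrite ?lerDl ?lerDr.
exists c, C, b; split; first by rewrite divr_gt0.
  exact: le_trans CC2.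
split.
- exact: bS.
- by move=> j; have [] := HN _ (bN j).
- move=> j; rewrite gamma_le//=; last exact: ltnW.
  by have := bt' j; lra.
- move=> j; have /andP[_ bt2] := bt' j.
  have := window_descent df a0 rec thb L1 lip tau0 tauL (ltnW (bS j)) (bt' j)
    (wE _ _ (bN j) (ltnW (bS j)) bt2).
  move=> /= /le_trans; apply; rewrite lerD2l -/C1.
  apply: (@le_trans _ _ (C1 * (Bn ^+ 2 * gamma alpha (b j) `^ (- (2 * p))))).
    by rewrite ler_wpM2l// E2.
  by rewrite mulrA ler_wpM2r ?powR_ge0.
- move=> j n /andP[jn nj].
  have gn : gamma alpha n - gamma alpha (b j) <= tau.
    have /andP[_] := bt' j; apply: le_trans; rewrite lerB//.
    by apply: gamma_le => //; exact: ltnW.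
  have tauL' : tau * L <= 1 / 40 by rewrite tauL.
  have [h1 h2] := window_bounds df a0 rec thb L1 lip (ltW tau0) tauL' jn gn
    (wE _ _ (bN j) jn gn).
  have h : C2 * (enorm (grad f (theta (b j))) ^+ 2 + E (b j) ^+ 2) <=
    C * (enorm (grad f (theta (b j))) ^+ 2 +
         gamma alpha (b j) `^ (- (2 * p))).
    rewrite !mulrDr lerD// ?ler_wpM2r ?sqr_ge0//.
    apply: (@le_trans _ _ (C2 * (Bn ^+ 2 * gamma alpha (b j) `^ (- (2 * p))))).
      by rewrite ler_wpM2l// E2.
    by rewrite mulrA ler_wpM2r ?powR_ge0.
  split.
  + by rewrite gamma_le//; clear -gn tau1; lra.
  + rewrite (le_trans _ h)// (le_trans h1)// ler_wpM2r//.
    by rewrite addr_ge0 ?sqr_ge0.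
  + exact: le_trans h2 h.
Unshelve. all: by end_near.
Qed.

(** The lower limit [a] of [f] along the block ends is the only candidate limit.
    The Lojasiewicz inequality at [a] turns the descent into
    [v' <= v - c |v| ^ (2 / mu) + C gamma ^ (- 2 p)] for [v = f - a], whose
    balanced rate is [q = mu p]: then [q * (2 / mu) = 2 p] matches the noise,
    and [2 p < q + 1] because [(2 - mu) p < 1]. *)
Lemma block_descent_rate (R : realType) (d : nat) (f : 'rV[R]_d -> R)
    (Q : set 'rV[R]_d) (theta : nat -> 'rV[R]_d) (gam : nat -> R)
    (p c C : R) (b : nat -> nat) :
  compact Q -> continuous f -> (forall n, Q (theta n)) ->
  gam n @[n --> \oo] --> +oo ->
  (forall a, (f @` Q) a -> exists delta mu M : R,
     [/\ 0 < delta < 1, 1 < mu <= 2, 1 <= M &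
         forall x, Q x -> `|f x - a| <= delta ->
           `|f x - a| <= M * enorm (grad f x) `^ mu]) ->
  0 < p <= 1 -> 0 < c -> 0 <= C ->
  descends_along_blocks (f \o theta) (fun n => enorm (grad f (theta n)))
    gam p c C b ->
  exists a q K, [/\ p < q, 0 <= K & \forall n \near \oo,
    enorm (grad f (theta n)) ^+ 2 <= K * gam n `^ (- q) /\
    `|f (theta n) - a| <= K * gam n `^ (- q)].
Proof.
move=> cQ cf Qth gy loj /andP[p0 p1] c0 C0 [bS x1 xS desc inb].
have cfQ : compact (f @` Q).
  by apply: continuous_compact => //; exact: continuous_subspaceT.
pose u j := f (theta (b j)).
pose x j := gam (b j).
pose G n := enorm (grad f (theta n)).
have fQu j : (f @` Q) (u j) by exists (theta (b j)).
have [A [_ HA]] := compact_bounded cfQ.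
have uA j : `|u j| <= A + 1 by apply: (HA (A + 1)) => //; rewrite ltrDl.
have [a [low freq]] := liminf_exists uA.
(* The Lojasiewicz inequality is available only at values of f on Q. *)
have fQa : (f @` Q) a.
  have := compact_closed (@norm_hausdorff _ _) cfQ; apply.
  move=> U /nbhs_ballP[e /= e0 eU].
  have e2 : 0 < e / 2 by rewrite divr_gt0.
  have [N _ HN] := low _ e2; have [j Nj uj] := freq _ N e2.
  exists (u j); split => //; apply: eU; rewrite -ball_normE/=.
  have := HN j Nj; rewrite /= => lj.
  by rewrite distrC (@le_lt_trans _ _ (e / 2)) ?ler_norml//; lra.
have [delta [mu [M [/andP[dl0 _] /andP[mu1 mu2] M1 lojQ]]]] := loj _ fQa.
have mu0 : 0 < mu by lra.
pose s := 2 / mu; pose q := mu * p.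
have s1 : 1 <= s by rewrite ler_pdivlMr// mul1r.
have s0 : 0 < s by lra.
have q0 : 0 < q by rewrite mulr_gt0.
have mus : mu * s = 2 by rewrite /s mulrCA divff ?mulr1// gt_eqF.
have qs : q * s = 2 * p by rewrite /q mulrAC mus.
have pq : p < q by rewrite /q ltr_pMl.
have q2p : q <= 2 * p by rewrite ler_wpM2r// ltW.
have qsq : q * s < q + 1.
  rewrite qs -ltrBlDl /q -mulrBl.
  have : (2 - mu) * p <= 2 - mu by rewrite ler_piMr//; lra.
  lra.
pose v j := u j - a.
have M0 : 0 < M by lra.
have Ms0 : 0 < M `^ s by rewrite powR_gt0.
(* Raising the Lojasiewicz inequality to the power s makes it quadratic in the
   gradient. *)
pose c' := c / M `^ s.
have c'0 : 0 < c' by rewrite divr_gt0.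
have lojv j : `|v j| <= delta -> c' * `|v j| `^ s <= c * G (b j) ^+ 2.
  move=> vd; have h := lojQ _ (Qth (b j)) vd.
  rewrite /c' -mulrA ler_wpM2l ?(ltW c0)// ler_pdivrMl//.
  apply: (@le_trans _ _ ((M * G (b j) `^ mu) `^ s)).
    apply: ge0_ler_powR; rewrite ?nnegrE ?(ltW s0)//.
    by rewrite mulr_ge0 ?powR_ge0// ltW.
  rewrite powRM ?powR_ge0 ?(ltW M0)// -powRrM mus.
  by rewrite (powR_mulrn 2) ?enorm_ge0.
have xoo : x j @[j --> \oo] --> +oo.
  apply/cvgryPge => T; have [N _ HN] := (cvgryPge gam).1 gy T.
  exists N => // j Nj; apply: HN => /=; rewrite (leq_trans Nj)//.
  by elim: (j) => // i IH; exact: leq_ltn_trans IH (bS i).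
have step j : v j.+1 <= v j - c * G (b j) ^+ 2 + C * x j `^ (- (2 * p)).
  by have := desc j; rewrite /v /u /x /G /=; lra.
have v_to0 : v j @[j --> \oo] --> (0 : R).
  pose e j := C * x j `^ (- (2 * p)).
  apply: (@cvg0_of_descent _ v e c' s delta) => //; rewrite /e.
  - apply/cvgrPdist_le => eps e0.
    have eC : 0 < eps / (C + 1) by rewrite divr_gt0// ltr_wpDl.
    have p20 : 0 < 2 * p by rewrite mulr_gt0.
    apply: filterS (powRN_le_near xoo p20 eC) => j.
    rewrite sub0r normrN ger0_norm ?mulr_ge0 ?powR_ge0//.
    rewrite ler_pdivlMr ?ltr_wpDl//; apply: le_trans.
    by rewrite mulrC ler_wpM2l ?powR_ge0// lerDl.
  - near=> j; apply: le_trans (step j) _; rewrite lerD2r gerBl.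
    by rewrite mulr_ge0 ?sqr_ge0// ltW.
  - near=> j => /lojv h; apply: le_trans (step j) _.
    by rewrite lerD2r lerD2l lerN2.
  - by move=> eps e0; apply: filterS (low _ e0) => j; rewrite /v lerBrDl.
  - move=> eps N e0; have [j Nj uj] := freq _ N e0.
    by exists j => //; rewrite /v lerBlDl.
have descent : \forall j \near \oo,
    v j.+1 <= v j - c' * `|v j| `^ s + C * x j `^ (- (q * s)).
  have /cvgrPdist_le /(_ _ dl0) := v_to0; apply: filterS => j.
  rewrite sub0r normrN qs => /lojv h; apply: le_trans (step j) _.
  by rewrite lerD2r lerD2l lerN2.
have x_le j : x j <= x j.+1 by have /andP[] := xS j.
have [Ku Ku0 up] := descent_rate_upper c'0 C0 s1 q0 qsq xS xoo descent.
have [Kl Kl0 lw] := descent_rate_lower c'0 C0 s1 q0 x_le xoo descent v_to0.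
pose K1 := Ku + Kl.
have K10 : 0 <= K1 by rewrite addr_ge0.
have [J _ HJ] : \forall j \near \oo, `|v j| <= K1 * x j `^ (- q).
  near=> j; rewrite ler_norml /K1 mulrDl.
  have : v j <= Ku * x j `^ (- q) by near: j.
  have : - (Kl * x j `^ (- q)) <= v j by near: j.
  have : 0 <= Kl * x j `^ (- q) by rewrite mulr_ge0 ?powR_ge0.
  have : 0 <= Ku * x j `^ (- q) by rewrite mulr_ge0 ?powR_ge0.
  by clear => *; apply/andP; split; lra.
pose K2 := (2 * K1 + C) / c.
have K20 : 0 <= K2 by rewrite divr_ge0 ?(ltW c0)// addr_ge0// mulr_ge0.
have x2p j : x j `^ (- (2 * p)) <= x j `^ (- q).
  exact: powRN_mono (x1 j) q2p.
(* Read backwards, the descent bounds the gradient by the decrease of v. *)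
have GJ j : (J <= j)%N -> G (b j) ^+ 2 <= K2 * x j `^ (- q).
  move=> Jj; rewrite /K2 mulrAC ler_pdivlMr// mulrC.
  have h1 := le_trans (ler_norm _) (HJ j Jj).
  have := HJ j.+1 (leqW Jj); rewrite /= ler_norml => /andP[h2 _].
  have h3 : K1 * x j.+1 `^ (- q) <= K1 * x j `^ (- q).
    rewrite ler_wpM2l// !powRN.
    rewrite lef_pV2 ?posrE ?powR_gt0 ?(lt_le_trans ltr01 (x1 _))//.
    by apply: ge0_ler_powR; rewrite ?nnegrE ?(ltW q0) ?(le_trans ler01 (x1 _)).
  have h4 : C * x j `^ (- (2 * p)) <= C * x j `^ (- q) by rewrite ler_wpM2l.
  by have := step j; clear -h1 h2 h3 h4; lra.
pose K3 := K1 + C * (K2 + 1).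
have CK : 0 <= C * (K2 + 1) by rewrite mulr_ge0 ?addr_ge0.
have K30 : 0 <= K3 by rewrite addr_ge0.
exists a, q, (K3 * 2 `^ q); split => //; first by rewrite mulr_ge0 ?powR_ge0.
exists (b J) => // n /= bJn.
have bmono : {homo b : i j / (i <= j)%N}.
  by apply: (homo_leq leqnn leq_trans) => i; exact: ltnW.
have [j /andP[jn nj]] := in_block bS (leq_trans (bmono _ _ (leq0n J)) bJn).
have Jj : (J <= j)%N.
  rewrite leqNgt; apply/negP => jJ.
  by have := leq_trans (bmono _ _ jJ) bJn; rewrite leqNgt nj.
have [/andP[ggn gn] fn Gn] := inb j n (introT andP (conj jn nj)).
have xj1 := x1 j; have xj0 : 0 < x j := lt_le_trans ltr01 xj1.
(* Inside a block gamma is at most twice its value at the left end. *)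
have X : x j `^ (- q) <= 2 `^ q * gam n `^ (- q).
  have gn0 : 0 < gam n := lt_le_trans xj0 ggn.
  rewrite !powRN ler_pdivlMr ?powR_gt0// ler_pdivrMl ?powR_gt0//.
  rewrite -powRM ?(ltW xj0)//; apply: ge0_ler_powR; rewrite ?nnegrE.
  - exact: ltW.
  - exact: ltW.
  - by rewrite mulr_ge0// ltW.
  - by move: gn xj1; rewrite -/(x j); clear => *; lra.
have XC : C * (G (b j) ^+ 2 + gam (b j) `^ (- (2 * p))) <=
    C * (K2 + 1) * x j `^ (- q).
  rewrite (_ : _ * x j `^ (- q) = C * (K2 * x j `^ (- q) + x j `^ (- q))).
    by rewrite ler_wpM2l// lerD//; [exact: GJ | exact: x2p].
  by ring.
have X0 := powR_ge0 (x j) (- q).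
have K3X : K3 * x j `^ (- q) <= K3 * 2 `^ q * gam n `^ (- q).
  by rewrite -mulrA ler_wpM2l.
split; apply: le_trans K3X.
  rewrite (le_trans Gn)// (le_trans XC)// ler_wpM2r// /K3 lerDr//.
rewrite (_ : _ - a = (f (theta n) - u j) + v j); last by rewrite addrA subrK.
rewrite (le_trans (ler_normD _ _))// /K3 mulrDl addrC lerD//; first exact: HJ.
exact: le_trans fn XC.
Unshelve. all: by end_near.
Qed.

(** * Little-o and the almost sure statement *)

Lemma dist_set_le (R : realType) (x y : R) (A : set R) : A y ->
  0 <= dist_set x A <= `|x - y|.
Proof.
move=> Ay; apply/andP; split.
  apply: lb_le_inf; first by exists `|x - y|, y.
  by move=> _ [z _ <-].
apply: ge_inf; last by exists y.
by exists 0 => _ [z _ <-].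
Qed.

Lemma littleo_powRN (R : realType) (gam u : nat -> R) (p q K : R) :
  gam n @[n --> \oo] --> +oo -> p < q -> 0 <= K ->
  (\forall n \near \oo, `|u n| <= K * gam n `^ (- q)) ->
  u =o_\oo (fun n => gam n `^ (- p)).
Proof.
move=> gy pq K0 uK; apply/eqoP => eps e0.
have K1 : 0 < K + 1 by rewrite ltr_wpDl.
have qp : 0 < q - p by rewrite subr_gt0.
near=> n.
have gn0 : 0 < gam n by near: n; apply: (cvgryPgt _).1.
have h1 : `|u n| <= K * gam n `^ (- q) by near: n.
have h2 : gam n `^ (- (q - p)) <= eps / (K + 1).
  by near: n; apply: powRN_le_near; rewrite ?divr_gt0.
rewrite [X in _ <= _ * X]ger0_norm ?powR_ge0// (le_trans h1)//.
rewrite (_ : - q = - (q - p) + - p); last by ring.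
rewrite powRD ?(gt_eqF gn0) ?implybT// mulrA ler_wpM2r ?powR_ge0//.
apply: (@le_trans _ _ ((K + 1) * gam n `^ (- (q - p)))).
  by rewrite ler_wpM2r ?powR_ge0// lerDl.
by rewrite mulrC -ler_pdivlMr.
Unshelve. all: by end_near.
Qed.

Lemma powRN_small (R : realType) (gam u : nat -> R) (q K eps : R) :
  gam n @[n --> \oo] --> +oo -> 0 < q -> 0 <= K ->
  (\forall n \near \oo, `|u n| <= K * gam n `^ (- q)) ->
  0 < eps -> \forall n \near \oo, `|u n| <= eps.
Proof.
move=> gy q0 K0 uK e0.
have K1 : 0 < K + 1 by rewrite ltr_wpDl.
near=> n.
have h1 : `|u n| <= K * gam n `^ (- q) by near: n.
have h2 : gam n `^ (- q) <= eps / (K + 1).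
  by near: n; apply: powRN_le_near; rewrite ?divr_gt0.
rewrite (le_trans h1)// (@le_trans _ _ ((K + 1) * gam n `^ (- q)))//.
  by rewrite ler_wpM2r ?powR_ge0// lerDl.
by rewrite mulrC -ler_pdivlMr.
Unshelve. all: by end_near.
Qed.

(** The rate [gamma ^ -q] with [q > p] improves on the claim; a cluster point of
    the path identifies the limit [a] of [f] as a critical value. *)
Lemma pathwise_rate (R : realType) (d : nat) (f : 'rV[R]_d -> R)
    (alpha : nat -> R) (theta w : nat -> 'rV[R]_d) (r B : R) :
  (forall x, differentiable f x) -> locally_lipschitz (grad f) ->
  (forall n, 0 < alpha n) ->
  (forall n, theta n.+1 = theta n - alpha n *: (grad f (theta n) + w n)) ->
  alpha n @[n --> \oo] --> (0 : R) -> gamma alpha n @[n --> \oo] --> +oo ->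
  0 < r -> (forall n, enorm (theta n) <= B) ->
  (limn_esup (fun n => (noise_max alpha r w n)%:E) < +oo)%E ->
  (forall Q : set 'rV[R]_d, compact Q ->
    forall a, (f @` Q) a ->
    exists delta mu M : R,
      [/\ 0 < delta < 1, 1 < mu <= 2, 1 <= M &
          forall x, Q x -> `|f x - a| <= delta ->
            `|f x - a| <= M * enorm (grad f x) `^ mu]) ->
  let p := Num.min 1 r in
  ((fun n => enorm (grad f (theta n)) ^+ 2)
     =o_\oo (fun n => gamma alpha n `^ (- p))) /\
  ((fun n => dist_set (f (theta n)) (f @` stationary f))
     =o_\oo (fun n => gamma alpha n `^ (- p))).
Proof.
move=> df glip a0 rec al0 gy r0 thB noise loj p.
have p01 : 0 < p <= 1 by rewrite lt_min ltr01 r0 ge_min lexx.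
have p0 : 0 < p by have /andP[] := p01.
have pr : p <= r by rewrite ge_min lexx orbT.
have thb n : box d B (theta n) by exact: in_box.
have cQ : compact (box d B) by exact: box_compact.
have [L L1 lip] := lipschitz_on_compact glip cQ.
have [Bn Bn0 nB] := limn_esup_bounded noise.
have [c [C [b [c0 C0 blocks]]]] :=
  exists_descending_blocks df a0 rec thb L1 lip al0 gy r0 pr Bn0 nB.
have cf : continuous f by move=> x; exact: differentiable_continuous.
have [a [q [K [pq K0 rate]]]] :=
  block_descent_rate cQ cf thb gy (loj _ cQ) p01 c0 C0 blocks.
have q0 : 0 < q := lt_trans p0 pq.
have g2rate : \forall n \near \oo,
    `|enorm (grad f (theta n)) ^+ 2| <= K * gamma alpha n `^ (- q).
  by apply: filterS rate => n [h _]; rewrite ger0_norm ?sqr_ge0.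
have frate : \forall n \near \oo,
    `|f (theta n) - a| <= K * gamma alpha n `^ (- q).
  by apply: filterS rate => n [].
have [x [gx fx]] : exists x, grad f x = 0 /\ f x = a.
  apply: (limit_value_critical cQ cf (le_trans ler01 L1) lip thb).
    move=> eps e0; have e2 : 0 < eps ^+ 2 by rewrite exprn_gt0.
    apply: filterS (powRN_small gy q0 K0 g2rate e2) => n.
    rewrite ger0_norm ?sqr_ge0// ler_pXn2r ?nnegrE ?enorm_ge0//; exact: ltW.
  by move=> eps e0; exact: powRN_small frate e0.
have Sa : (f @` stationary f) a by exists x.
split; first exact: littleo_powRN g2rate.
apply: (littleo_powRN gy pq K0); apply: filterS frate => n.
apply: le_trans; have /andP[h1 h2] := dist_set_le (f (theta n)) Sa.
by rewrite ger0_norm.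
Qed.

Theorem corollary2p4 (R : realType) (d : nat)
    (disp : measure_display) (Omega : measurableType disp)
    (P : probability Omega R)
    (f : 'rV[R]_d -> R) (alpha : nat -> R)
    (theta w : nat -> Omega -> 'rV[R]_d) (r : R)
    (f_diff : forall x, differentiable f x)
    (grad_lip : locally_lipschitz (grad f))
    (alpha_gt0 : forall n, 0 < alpha n)
    (theta0_rv : random_vector (theta 0%N))
    (w_rv : forall n, random_vector (w n))
    (theta_rec : forall n omega,
      theta n.+1 omega =
        theta n omega - alpha n *: (grad f (theta n omega) + w n omega))
    (alpha_to0 : alpha n @[n --> \oo] --> 0)
    (alpha_sum : (\sum_(0 <= n <oo) (alpha n)%:E = +oo)%E)
    (r_gt0 : 0 < r)
    (noise : {ae P, forall omega, bounded_paths theta omega ->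
      (limn_esup (fun n =>
         (noise_max alpha r (fun i => w i omega) n)%:E) < +oo)%E})
    (lojasiewicz : forall Q : set 'rV[R]_d, compact Q ->
      forall a, (f @` Q) a ->
      exists delta mu M : R,
        [/\ 0 < delta < 1, 1 < mu <= 2, 1 <= M &
            forall x, Q x -> `|f x - a| <= delta ->
              `|f x - a| <= M * enorm (grad f x) `^ mu]) :
  let p := Num.min 1 r in
  {ae P, forall omega, bounded_paths theta omega ->
    ((fun n => enorm (grad f (theta n omega)) ^+ 2)
       =o_\oo (fun n => gamma alpha n `^ (- p))) /\
    ((fun n => dist_set (f (theta n omega)) (f @` stationary f))
       =o_\oo (fun n => gamma alpha n `^ (- p)))}.
Proof.
move=> p; apply: filterS noise => omega noise bdd.
have [B thB] : exists B, forall n, enorm (theta n omega) <= B.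
  move: (bdd); rewrite /bounded_paths/=.
  have ub n :=
    ereal_sup_ubound (imageT (fun n => (enorm (theta n omega))%:E) n).
  move: ub; case: ereal_sup => [s| |]// ub _.
  - by exists s => n; rewrite -lee_fin ub.
  - by have := ub 0%N; rewrite leeNy_eq.
exact: (pathwise_rate f_diff grad_lip alpha_gt0 (theta_rec^~ omega) alpha_to0
  (gamma_cvgy alpha_gt0 alpha_sum) r_gt0 thB (noise bdd) lojasiewicz).
Qed.
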